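(* Let $H$ be a separable Hilbert space, let $(X_t)_{t\geq 1}$ be $H$-valued and $(\epsilon_t)_{t\geq1}$ real-valued, and $(\mathcal{F}_t)_{t\geq 0}$ a filtration such that for all $t\ge1$: $X_t$ is $\mathcal{F}_{t-1}$-measurable, $\epsilon_t$ is $\mathcal{F}_t$-measurable, $\mathbb{E}[\epsilon_t\mid\mathcal{F}_{t-1}]=0$, $|\epsilon_t|\le B$, and $\mathrm{Var}(\epsilon_t\mid\mathcal{F}_{t-1})=\sigma^2$ for a constant $\sigma^2$. Fix $\rho>0$ and set $V_t=\sum_{i\leq t}X_iX_i^T$, $M_t=\sum_{i\le t}X_i\epsilon_i$, $G_t=(\rho I+V_t)^{-1/2}X_t$. Let $\delta_1,\delta_2>0$ with $\delta_1+\delta_2<1$, and let $(\hat\sigma^2_{u,t,\delta_1})_t$ be random variables such that $\mathbb{P}(\hat\sigma^2_{u,t,\delta_1}\ge\sigma^2 \text{ for all } t)\ge1-\delta_1$. Set $$s_t=\|(\rho I+V_t)^{-1/2}M_t\|,\qquad \hat\nu_t=\hat\sigma^2_{u,t,\delta_1}\sum_{i\le t}\|G_i\|^2.$$ Then for every $\theta>0$, $$\mathbb{P}\left(\sup_t \frac{(\theta/B^2)^{\theta/B^2}}{\Gamma(\theta/B^2)\,\overline{\gamma}(\theta/B^2,\theta/B^2)}\cdot\frac{\Gamma\big(\frac{Bs_t+\hat\nu_t+\theta}{B^2}\big)\,\overline{\gamma}\big(\frac{Bs_t+\hat\nu_t+\theta}{B^2},\frac{\hat\nu_t+\theta}{B^2}\big)}{\big(\frac{\hat\nu_t+\theta}{B^2}\big)^{\frac{Bs_t+\hat\nu_t+\theta}{B^2}}}\exp\Big(\frac{\hat\nu_t}{B^2}\Big)<\frac{2}{\delta_2}\right)\ge1-\delta_1-\delta_2,$$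 where $\overline{\gamma}(a,x)=\frac{1}{\Gamma(a)}\int_x^\infty u^{a-1}e^{-u}\,du$ is the regularized upper incomplete gamma function.
   Context: For $f,g\in H$, $fg^T$ denotes the operator $f\langle g,\cdot\rangle$ on $H$, and $I$ is the identity operator on $H$. *)

(* Defs.v *)
From HB Require Import structures.
From mathcomp Require Import all_boot all_order all_algebra.
From mathcomp Require Import all_classical all_reals all_analysis.
From Stdlib Require Import ClassicalEpsilon.
Set Implicit Arguments. Unset Strict Implicit. Unset Printing Implicit Defensive.
Import Order.TTheory GRing.Theory Num.Theory.
Local Open Scope classical_set_scope.
Local Open Scope ring_scope.

Section Defs.
Context {R : realType}.

Section Hilbert.
Context {H : lmodType R} (ip : H -> H -> R).

Definition hnorm (x : H) : R := Num.sqrt (ip x x).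

Definition real_separable_hilbert : Prop :=
  [/\ (forall x y, ip x y = ip y x),
      (forall (a : R) x y z, ip (a *: x + y) z = a * ip x z + ip y z),
      (forall x, 0 <= ip x x /\ (ip x x = 0 -> x = 0)),
      (forall u : nat -> H,
         (forall e : R, 0 < e -> exists N, forall m n, (N <= m)%N -> (N <= n)%N ->
             hnorm (u m - u n) < e) ->
         exists l, forall e : R, 0 < e -> exists N, forall n, (N <= n)%N ->
             hnorm (u n - l) < e) &
      (exists d : nat -> H, forall x (e : R), 0 < e -> exists n, hnorm (x - d n) < e)].

Definition hopen (U : set H) : Prop :=
  forall x, U x -> exists2 e : R, 0 < e & forall y, hnorm (y - x) < e -> U y.

Definition pos_sa_op (A : H -> H) : Prop :=
  [/\ (forall (a : R) x y, A (a *: x + y) = a *: A x + A y),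
      (exists C : R, forall x, hnorm (A x) <= C * hnorm x),
      (forall x y, ip (A x) y = ip x (A y)) &
      (forall x, 0 <= ip (A x) x)].

(* T^{-1/2}: the (unique) positive self-adjoint bounded operator S with
   S^2 the two-sided inverse of T. *)
Definition inv_sqrt_op (T : H -> H) : H -> H :=
  epsilon (inhabits (fun x : H => x))
    (fun S => pos_sa_op S /\
       (forall x, S (S (T x)) = x) /\ (forall x, T (S (S x)) = x)).

Definition rank_one (f g : H) : H -> H := fun x => ip g x *: f.

End Hilbert.

Section Prob.
Context {d : measure_display} {Omega : measurableType d}.

Definition sub_sigma (G : set (set Omega)) : Prop :=
  sigma_algebra setT G /\ G `<=` measurable.

Definition filtration (F : nat -> set (set Omega)) : Prop :=
  (forall t, sub_sigma (F t)) /\ (forall s t, (s <= t)%N -> F s `<=` F t).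

Definition Gmeas_R (G : set (set Omega)) (f : Omega -> R) : Prop :=
  forall U : set R, measurable U -> G (f @^-1` U).

Definition Gmeas_H {H : lmodType R} (ip : H -> H -> R) (G : set (set Omega))
  (f : Omega -> H) : Prop :=
  forall U : set H, hopen ip U -> G (f @^-1` U).

Definition is_condexp (P : probability Omega R) (G : set (set Omega))
  (Y Z : Omega -> R) : Prop :=
  [/\ P.-integrable setT (EFin \o Y), Gmeas_R G Z, P.-integrable setT (EFin \o Z) &
      forall A, G A -> (\int[P]_(w in A) (Y w)%:E = \int[P]_(w in A) (Z w)%:E)%E].

Definition is_condvar (P : probability Omega R) (G : set (set Omega))
  (Y V : Omega -> R) : Prop :=
  exists Z, is_condexp P G Y Z /\ is_condexp P G (fun w => (Y w - Z w) ^+ 2) V.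

End Prob.

Definition GammaF (a : R) : R :=
  fine (\int[@lebesgue_measure R]_(u in [set u : R | (0 <= u)%R])
          (powR u (a - 1) * expR (- u))%R%:E)%E.

Definition gbar (a x : R) : R :=
  (GammaF a)^-1 * fine (\int[@lebesgue_measure R]_(u in [set u : R | (x <= u)%R])
          (powR u (a - 1) * expR (- u))%R%:E)%E.

End Defs.

(* Main.v *)
Require Import Defs.
From HB Require Import structures.
From mathcomp Require Import all_boot all_order all_algebra.
From mathcomp Require Import all_classical all_reals all_analysis.
From mathcomp Require Import measurable_realfun ring lra.
From Stdlib Require Import ClassicalEpsilon.
Import Order.TTheory GRing.Theory Num.Theory.
Import numFieldNormedType.Exports.
Local Open Scope classical_set_scope.
Local Open Scope ring_scope.

(** The Sherman-Morrison recursion computes the quadratic form of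
    [(rho I + V_t)^-1], so that [s_t ^ 2 = A + 2 eps_t b + eps_t ^ 2 g] where [A],
    [b], [g] are the values of that form on [M_(t-1)] and [X_t]; here
    [g = |G_t|^2 <= 1], [b^2 <= A g] and [A <= s_(t-1)^2].  As [q |-> cosh (sqrt q)]
    is convex, [cosh (lam s_t)] lies below its linear interpolation in the angle
    [b / sqrt (A g)], which yields
    [cosh (lam s_t) <= cosh (lam sqrt A) (1 + psi(lam) g eps_t^2) + eps_t D] with [D]
    predictable and [psi(lam) = (exp (lam B) - 1 - lam B) / B^2].  Hence
    [cosh (lam s_t) exp (- psi(lam) sigma^2 \sum_(i <= t) |G_i|^2)] is a nonnegative
    supermartingale for each [lam >= 0].  Mixing over [lam] with density proportional
    to [exp (- theta psi(lam))] and substituting [v = exp (B lam)] turns the mixture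
    into an incomplete gamma integral that dominates half of the quantity in the
    statement as soon as [sigma^2 <= shat_t]; Ville's inequality concludes. *)

(** * Inverse square roots of [rho I + V] *)

(** [inv_sqrt_op] is chosen by [epsilon], so nothing is known about it until some inverse square
    root has been exhibited; in infinite dimension this is done by summing the binomial series of
    [(1 - x)^(-1/2)] at a contraction. Once [|S y|^2 = <R y, y>] is known, with [R] the
    Sherman-Morrison inverse, the operator [S] disappears: the form of [R] is a rational expression
    in scalar products, so predictability reduces to measurability of [<X_i, X_j>].

    Using [V_t], which already contains [X_t], is what gives [|G_t| <= 1], hence
    [|eps_t| |G_t| <= B] and an increment controlled by [psi(lam)] whatever the size of [X_t].

    Conditional expectations are handled only through integrals over sets of the filtration. Taking
    out a known factor is proved for nonnegative functions by slicing into level sets; the signed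
    term [eps_t D] is made nonnegative by adding [B |D|] to both sides, and this is cancelled
    afterwards because [D] is bounded at each fixed time.

    The loss of a factor 2 in the final threshold comes from [exp x <= 2 cosh x]. *)

Lemma geometric_small (R : realType) (q c e : R) : 0 <= q -> q < 1 -> 0 < e ->
  exists N, forall n, (N <= n)%N -> c * q ^+ n < e.
Proof.
move=> q0 q1 e0.
have : (fun n => c * q ^+ n) @ \oo --> c * 0.
  by apply: cvgMr; apply: cvg_expr; rewrite ger0_norm.
rewrite mulr0 => /cvgrPdist_lt /(_ e e0) [N _ hN].
exists N => n Nn; have /= := hN n Nn.
by rewrite sub0r normrN; apply: le_lt_trans; exact: ler_norm.
Qed.

(** The device for passing to the limit in the operator series: the defect of an identity is bounded
    by a constant times [q ^+ n] for every [n], hence vanishes. *)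
Lemma le0_geometric (R : realType) (q c a : R) : 0 <= q -> q < 1 ->
  (forall n, a <= c * q ^+ n) -> a <= 0.
Proof.
move=> q0 q1 h; case: leP => // a0.
have [N /(_ N (leqnn _))] := @geometric_small R q c a q0 q1 a0.
by rewrite ltNge h.
Qed.

Section Form.
Context {R : realType} {H : lmodType R} (K : H -> H -> R).
Hypothesis Ksym : forall x y, K x y = K y x.
Hypothesis Klin : forall a x y z, K (a *: x + y) z = a * K x z + K y z.

Lemma form0l z : K 0 z = 0.
Proof.
by have := Klin 1 0 0 z; rewrite scaler0 addr0 mul1r => /eqP; rewrite -subr_eq0 opprD addNKr oppr_eq0 => /eqP.
Qed.
Lemma formDl x y z : K (x + y) z = K x z + K y z.
Proof. by have := Klin 1 x y z; rewrite scale1r mul1r. Qed.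
Lemma formZl a x z : K (a *: x) z = a * K x z.
Proof. by have := Klin a x 0 z; rewrite !addr0 form0l addr0. Qed.
Lemma formNl x z : K (- x) z = - K x z.
Proof. by rewrite -scaleN1r formZl mulN1r. Qed.
Lemma form_suml (I : Type) (r : seq I) (Q : pred I) (f : I -> H) z :
  K (\sum_(i <- r | Q i) f i) z = \sum_(i <- r | Q i) K (f i) z.
Proof. by apply: (big_morph (K^~ z)); [move=> x y; exact: formDl|exact: form0l]. Qed.
Lemma form0r z : K z 0 = 0. Proof. by rewrite Ksym form0l. Qed.
Lemma formDr x y z : K z (x + y) = K z x + K z y.
Proof. by rewrite Ksym formDl !(Ksym z). Qed.
Lemma formZr a x z : K z (a *: x) = a * K z x.
Proof. by rewrite Ksym formZl (Ksym z). Qed.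
Lemma formNr x z : K z (- x) = - K z x.
Proof. by rewrite Ksym formNl (Ksym z). Qed.
Lemma form_sumr (I : Type) (r : seq I) (Q : pred I) (f : I -> H) z :
  K z (\sum_(i <- r | Q i) f i) = \sum_(i <- r | Q i) K z (f i).
Proof. by rewrite Ksym form_suml; under eq_bigr do rewrite Ksym. Qed.

(** Only semidefiniteness is assumed, so that the inequality also covers forms such as [ip (C y) z].
    If one diagonal value is positive, expanding a suitable square suffices; if both vanish, the
    vector [x - K x y *: y] gives [- 2 (K x y)^2 >= 0]. *)
Lemma form_CS : (forall x, 0 <= K x x) -> forall x y, K x y ^+ 2 <= K x x * K y y.
Proof.
move=> K0 x y; have Kxx := K0 x; have Kyy := K0 y.
have h1 := K0 (K y y *: x - K x y *: y).
have h2 := K0 (K x x *: y - K x y *: x).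
have h3 := K0 (x - K x y *: y).
move: h1 h2 h3.
rewrite !(formDl, formDr, formNl, formNr, formZl, formZr) (Ksym y x).
move: (K x x) (K y y) (K x y) Kxx Kyy => a c b a0 c0 h1 h2 h3.
have {h1}h1 : 0 <= c * (a * c - b ^+ 2) by lra.
have {h2}h2 : 0 <= a * (a * c - b ^+ 2) by lra.
have [a1|a1] := ltP 0 a; first by rewrite -subr_ge0 -(pmulr_rge0 _ a1).
have [c1|c1] := ltP 0 c; first by rewrite -subr_ge0 -(pmulr_rge0 _ c1).
have -> : a = 0 by apply/eqP; rewrite eq_le a1.
have c00 : c = 0 by apply/eqP; rewrite eq_le c1.
by move: h3; rewrite c00; have := sqr_ge0 b; lra.
Qed.
End Form.

Section Hilbert.
Context {R : realType} {H : lmodType R} (ip : H -> H -> R).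
Hypothesis ipH : real_separable_hilbert ip.

Lemma ip_sym x y : ip x y = ip y x. Proof. by case: ipH. Qed.
Lemma ip_lin a x y z : ip (a *: x + y) z = a * ip x z + ip y z.
Proof. by case: ipH. Qed.
Lemma ip_ge0 x : 0 <= ip x x. Proof. by case: ipH => _ _ /(_ x) []. Qed.

Let ipE := (formDl _ ip_lin, formDr _ ip_sym ip_lin, formNl _ ip_lin, formNr _ ip_sym ip_lin,
  formZl _ ip_lin, formZr _ ip_sym ip_lin).

Lemma hnorm_ge0 x : 0 <= hnorm ip x. Proof. exact: sqrtr_ge0. Qed.
Lemma sqr_hnorm x : hnorm ip x ^+ 2 = ip x x.
Proof. by rewrite sqr_sqrtr// ip_ge0. Qed.
Lemma hnorm_le x (c : R) : 0 <= c -> ip x x <= c ^+ 2 -> hnorm ip x <= c.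
Proof. by move=> c0 h; rewrite -(@ler_pXn2r _ 2)// ?nnegrE ?hnorm_ge0// sqr_hnorm. Qed.
Lemma hnormZ a x : hnorm ip (a *: x) = `|a| * hnorm ip x.
Proof. by rewrite /hnorm !ipE mulrA -expr2 sqrtrM ?sqr_ge0// sqrtr_sqr. Qed.
Lemma hnormN x : hnorm ip (- x) = hnorm ip x.
Proof. by rewrite -scaleN1r hnormZ normrN1 mul1r. Qed.
Lemma hnorm0 : hnorm ip 0 = 0.
Proof. by rewrite -(scale0r 0) hnormZ normr0 mul0r. Qed.
Lemma hnorm_eq0 x : hnorm ip x <= 0 -> x = 0.
Proof.
move=> h; case: ipH => _ _ /(_ x) [_ h0] _ _; apply: h0.
by rewrite -sqr_hnorm; apply/eqP; rewrite sqrf_eq0 eq_le h hnorm_ge0.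
Qed.
Lemma ip_CS x y : `|ip x y| <= hnorm ip x * hnorm ip y.
Proof.
rewrite -(@ler_pXn2r _ 2)// ?nnegrE ?mulr_ge0 ?hnorm_ge0//.
rewrite exprMn !sqr_hnorm real_normK ?num_real//.
exact: (form_CS _ ip_sym ip_lin ip_ge0).
Qed.
Lemma hnormD x y : hnorm ip (x + y) <= hnorm ip x + hnorm ip y.
Proof.
apply: hnorm_le; first by rewrite addr_ge0 ?hnorm_ge0.
rewrite !ipE -!sqr_hnorm (ip_sym y x).
have := le_trans (ler_norm _) (ip_CS x y); lra.
Qed.
Lemma hnorm_distD x y z : hnorm ip (x - z) <= hnorm ip (x - y) + hnorm ip (y - z).
Proof. by rewrite -[x - z](subrKA y); exact: hnormD. Qed.

(** * The binomial series for [(I - C)^(-1/2)] with [0 <= C] and [|C| <= q < 1] *)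

Section PowerSeries.
Variables (C : H -> H) (q : R).
Hypothesis Clin : forall (a : R) x y, C (a *: x + y) = a *: C x + C y.
Hypothesis Csym : forall x y, ip (C x) y = ip x (C y).
Hypothesis Cpos : forall x, 0 <= ip (C x) x.
Hypothesis q0 : 0 <= q.
Hypothesis q1 : q < 1.
Hypothesis Cq : forall x, hnorm ip (C x) <= q * hnorm ip x.

Lemma linop0 : C 0 = 0.
Proof.
by have := Clin 1 0 0; rewrite scaler0 addr0 scale1r => /eqP; rewrite -subr_eq0 opprD addNKr oppr_eq0 => /eqP.
Qed.
Lemma linopD x y : C (x + y) = C x + C y.
Proof. by have := Clin 1 x y; rewrite !scale1r. Qed.
Lemma linopZ a x : C (a *: x) = a *: C x.
Proof. by have := Clin a x 0; rewrite !addr0 linop0 addr0. Qed.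
Lemma linop_sum (I : Type) (r : seq I) (Q : pred I) (f : I -> H) :
  C (\sum_(i <- r | Q i) f i) = \sum_(i <- r | Q i) C (f i).
Proof. by apply: (big_morph C); [exact: linopD|exact: linop0]. Qed.

(** Evaluation of [p] at the operator [C]. Composites of truncated series become products in the
    commutative ring [{poly R}], where coefficients can be compared. *)
Definition poly_act (p : {poly R}) (x : H) : H :=
  \sum_(i < size p) p`_i *: iter i C x.

Lemma poly_act_wide n (p : {poly R}) x : (size p <= n)%N ->
  poly_act p x = \sum_(i < n) p`_i *: iter i C x.
Proof.
move=> sp; rewrite /poly_act (big_ord_widen n (fun i => p`_i *: iter i C x)) //.
rewrite big_mkcond; apply: eq_bigr => i _; case: ltnP => // si.
by rewrite nth_default// scale0r.
Qed.

Lemma poly_actD p1 p2 x : poly_act (p1 + p2) x = poly_act p1 x + poly_act p2 x.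
Proof.
pose n := maxn (size (p1 + p2)) (maxn (size p1) (size p2)).
rewrite !(poly_act_wide n) ?leq_max ?leqnn ?orbT// -big_split/=.
by apply: eq_bigr => i _; rewrite coefD scalerDl.
Qed.

Lemma poly_actZ a p x : poly_act (a *: p) x = a *: poly_act p x.
Proof.
rewrite !(poly_act_wide (size p))// ?size_scale_leq// scaler_sumr.
by apply: eq_bigr => i _; rewrite coefZ scalerA.
Qed.

Lemma poly_actB p1 p2 x : poly_act (p1 - p2) x = poly_act p1 x - poly_act p2 x.
Proof. by rewrite poly_actD -[- p2]scaleN1r poly_actZ scaleN1r. Qed.

Lemma poly_actMX p x : poly_act (p * 'X) x = C (poly_act p x).
Proof.
rewrite (poly_act_wide (size p).+1); last first.
  by rewrite (leq_trans (size_polyMleq _ _))// size_polyX addn2.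
rewrite big_ord_recl coefMX/= scale0r add0r linop_sum.
by apply: eq_bigr => i _; rewrite coefMX/= linopZ.
Qed.

Lemma poly_actC a x : poly_act a%:P x = a *: x.
Proof. by rewrite (poly_act_wide 1) ?size_polyC_leq1// big_ord1 coefC. Qed.

Lemma poly_actM p1 p2 x : poly_act (p1 * p2) x = poly_act p1 (poly_act p2 x).
Proof.
elim/poly_ind: p1 => [|p c IH].
  by rewrite mul0r -[0]/(0%:P) !poly_actC !scale0r.
rewrite mulrDl mulrAC !poly_actD !poly_actMX IH; congr (_ + _).
by rewrite mul_polyC poly_actZ poly_actC.
Qed.

Lemma poly_act_opC p x : poly_act p (C x) = C (poly_act p x).
Proof.
rewrite -{1}[x]scale1r -poly_actC -poly_actMX mul1r.
by rewrite -poly_actM poly_actMX.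
Qed.

Lemma poly_act_lin p a x y : poly_act p (a *: x + y) = a *: poly_act p x + poly_act p y.
Proof.
rewrite /poly_act scaler_sumr -big_split/=; apply: eq_bigr => i _.
have -> : iter i C (a *: x + y) = a *: iter i C x + iter i C y.
  by elim: (nat_of_ord i) => //= k ->.
by rewrite scalerDr !scalerA [a * _]mulrC.
Qed.

Lemma poly_act_sym p x y : ip (poly_act p x) y = ip x (poly_act p y).
Proof.
rewrite /poly_act (form_suml _ ip_lin) (form_sumr _ ip_sym ip_lin); apply: eq_bigr => i _.
rewrite !ipE; congr (_ * _).
by elim: (nat_of_ord i) x y => //= k IH x y; rewrite Csym IH -iterSr.
Qed.

Lemma poly_act_pos (p : {poly R}) x : (forall i, 0 <= p`_i) -> 0 <= ip (poly_act p x) x.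
Proof.
move=> p0; rewrite /poly_act (form_suml _ ip_lin); apply: sumr_ge0 => i _.
rewrite !ipE mulr_ge0//.
have iter_sym k : forall u v, ip (iter k C u) v = ip u (iter k C v).
  by elim: k => //= k IH u v; rewrite Csym IH -iterSr.
(* Half of the factors [C] move to the other argument: with [k] half of [i], an even power gives
   [|C^k x|^2] and an odd one [<C^k x, C (C^k x)>]. *)
rewrite -[nat_of_ord i]odd_double_half -addnn addnA iterD iter_sym.
case: (odd i) => /=; last by rewrite add0n; exact: ip_ge0.
by rewrite ip_sym; exact: Cpos.
Qed.

Lemma hnorm_iter i x : hnorm ip (iter i C x) <= q ^+ i * hnorm ip x.
Proof.
elim: i => /= [|i IH]; first by rewrite mul1r.
by apply: le_trans (Cq _) _; rewrite exprS -mulrA ler_wpM2l.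
Qed.

(** The one estimate behind every truncation error: what is left is dominated by the geometric tail
    [q^n + q^(n+1) + ...]. The inner induction carries the factor [1 - q] so that the sum
    telescopes. *)
Lemma poly_act_bound n (p : {poly R}) x : (forall m, (m < n)%N -> p`_m = 0) ->
  (forall m, `|p`_m| <= 1) ->
  hnorm ip (poly_act p x) <= (1 - q)^-1 * hnorm ip x * q ^+ n.
Proof.
move=> p0 p1; have x0 := hnorm_ge0 x.
have q1' : 0 < 1 - q by rewrite subr_gt0.
have h k : hnorm ip (\sum_(i < n + k) p`_i *: iter i C x) * (1 - q)
            <= (q ^+ n - q ^+ (n + k)) * hnorm ip x.
  elim: k => [|k IH].
    rewrite addn0 big1 ?hnorm0 ?subrr ?mul0r// => i _.
    by rewrite p0 ?scale0r.
  rewrite addnS big_ord_recr/= exprS.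
  have h1 := hnormD (\sum_(i < n + k) p`_i *: iter i C x) (p`_(n + k) *: iter (n + k) C x).
  have h2 : hnorm ip (p`_(n + k) *: iter (n + k) C x) <= q ^+ (n + k) * hnorm ip x.
    rewrite hnormZ; apply: le_trans (hnorm_iter _ _).
    by rewrite ler_piMl ?hnorm_ge0.
  apply: (@le_trans _ _ ((hnorm ip (\sum_(i < n + k) p`_i *: iter i C x)
      + q ^+ (n + k) * hnorm ip x) * (1 - q))).
    by rewrite ler_wpM2r// ?(ltW q1')// (le_trans h1)// lerD2l.
  by rewrite mulrDl; apply: le_trans (lerD IH (lexx _)) _; lra.
rewrite (poly_act_wide (n + size p)) ?leq_addl//.
rewrite -mulrA -ler_pdivrMl ?invr_gt0// invrK mulrC; apply: le_trans (h _) _.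
by rewrite mulrC ler_wpM2l// gerBl exprn_ge0.
Qed.

(** The normalised central binomial coefficients [binom(2n, n) / 4^n]. *)
Fixpoint invsqrt_coef (n : nat) : R :=
  if n is m.+1 then invsqrt_coef m * ((2 * m%:R + 1) / (2 * m%:R + 2)) else 1.

Lemma invsqrt_coef_bounds n : 0 <= invsqrt_coef n <= 1.
Proof.
elim: n => [|n /andP[h0 h1]] /=; first by rewrite ler01 lexx.
have n0 := ler0n R n; have d0 : 0 <= (2 * n%:R + 1) / (2 * n%:R + 2) :> R.
  by rewrite divr_ge0//; lra.
rewrite mulr_ge0//= mulr_ile1//.
by rewrite ler_pdivrMr; lra.
Qed.

(** The differential equation [2 (1 - x) f' = f] of [f = (1 - x)^(-1/2)], read on coefficients. *)
Lemma invsqrt_coefS n : n.+1%:R * invsqrt_coef n.+1 = (n%:R + 2^-1) * invsqrt_coef n.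
Proof.
rewrite /= [LHS]mulrCA [RHS]mulrC; congr (_ * _).
rewrite -natr1; field.
by apply: lt0r_neq0; have := ler0n R n; lra.
Qed.

(* These are the coefficients of [(1 - x)^(-1/2)], whose square is [(1 - x)^-1]; with
   [c_n] the left-hand side, the recurrence gives [(n+1) c_(n+1) = (n+1) c_n]. *)
Lemma invsqrt_coef_conv n : \sum_(i < n.+1) invsqrt_coef i * invsqrt_coef (n - i) = 1.
Proof.
elim: n => [|n IH]; first by rewrite big_ord1 /= mulr1.
set b := invsqrt_coef.
(* Averaging the sum with its reversal [i -> m - i] replaces the weight [i] by [m / 2]. *)
have sw m : \sum_(i < m.+1) (i%:R * (b i * b (m - i)%N)) * 2
          = m%:R * \sum_(i < m.+1) b i * b (m - i)%N.
  rewrite -mulr_suml mulr_natr mulr2n {1}(reindex_inj rev_ord_inj)/= -big_split/= mulr_sumr.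
  apply: eq_bigr => i _; rewrite subSS subKn ?leq_ord//.
  by rewrite natrB ?leq_ord// [b i * _]mulrC; ring.
have n1 : n.+1%:R != 0 :> R by rewrite pnatr_eq0.
apply: (mulfI n1); rewrite mulr1 -sw big_ord_recl mul0r mul0r add0r.
rewrite (eq_bigr (fun i : 'I_n.+1 => (i%:R * (b i * b (n - i)%N)) * 2 + b i * b (n - i)%N)).
  by rewrite big_split/= sw IH mulr1 natr1.
move=> i _; rewrite lift0 subSS mulrA invsqrt_coefS -/b.
by field.
Qed.

Definition invsqrt_poly n : {poly R} := \poly_(i < n) invsqrt_coef i.

(** Truncation only drops nonnegative terms from a convolution equal to 1, and drops none in degrees
    below [n]. *)
Lemma invsqrt_poly_sqr_coef n m :
  0 <= (invsqrt_poly n * invsqrt_poly n)`_m <= 1 /\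
  ((m < n)%N -> (invsqrt_poly n * invsqrt_poly n)`_m = 1).
Proof.
have b0 i : 0 <= invsqrt_coef i by case/andP: (invsqrt_coef_bounds i).
rewrite coefM; split; last first.
  move=> mn; rewrite -(invsqrt_coef_conv m); apply: eq_bigr => i _; rewrite !coef_poly.
  by rewrite !(leq_ltn_trans _ mn)// ?leq_subr// leq_ord.
rewrite sumr_ge0/= => [|i _]; last by rewrite !coef_poly; do 2 case: ifP => _; rewrite ?mulr_ge0// ?mul0r ?mulr0.
rewrite -(invsqrt_coef_conv m); apply: ler_sum => i _; rewrite !coef_poly.
by do 2 case: ifP => _; rewrite ?mul0r ?mulr0 ?mulr_ge0.
Qed.

(** With [p] the truncation, [p^2 (1 - 'X) - 1] has no coefficient below degree [n], and the others
    are differences of two numbers in [[0, 1]]; [poly_act_bound] then applies. *)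
Lemma invsqrt_poly_resid_bound n x :
  hnorm ip (poly_act (invsqrt_poly n) (poly_act (invsqrt_poly n) (x - C x)) - x)
  <= (1 - q)^-1 * hnorm ip x * q ^+ n.
Proof.
set p := invsqrt_poly n.
have -> : poly_act p (poly_act p (x - C x)) - x = poly_act (p * p - p * p * 'X - 1) x.
  rewrite !poly_actB poly_actMX -[1]/(1%:P) poly_actC scale1r -!poly_actM; congr (_ - _).
  have := poly_act_lin (p * p) (-1) (C x) x; rewrite !scaleN1r addrC => ->.
  by rewrite addrC poly_act_opC.
apply: poly_act_bound => m.
  move=> mn; rewrite !coefB coefMX coef1.
  have [_ /(_ mn) ->] := invsqrt_poly_sqr_coef n m.
  case: m mn => [|m] mn /=; first by rewrite subr0 subrr.
  by have [_ /(_ (ltnW mn)) ->] := invsqrt_poly_sqr_coef n m; rewrite subrr subr0.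
rewrite !coefB coefMX coef1.
have [/andP[]] := invsqrt_poly_sqr_coef n m; rewrite -/p.
case: m => [|m] /=; first by rewrite subr0 => *; rewrite ler_norml; lra.
by have [/andP[]] := invsqrt_poly_sqr_coef n m; rewrite -/p subr0 => *; rewrite ler_norml; lra.
Qed.

Lemma invsqrt_poly_diff_bound N n m x : (N <= n)%N -> (N <= m)%N ->
  hnorm ip (poly_act (invsqrt_poly n) x - poly_act (invsqrt_poly m) x)
  <= (1 - q)^-1 * hnorm ip x * q ^+ N.
Proof.
move=> Nn Nm; rewrite -poly_actB; apply: poly_act_bound => k.
  by move=> kN; rewrite coefB !coef_poly !(leq_trans kN)// subrr.
rewrite coefB !coef_poly; have /andP[h0 h1] := invsqrt_coef_bounds k.
by do 2 case: ifP => _; rewrite ler_norml; lra.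
Qed.

(** Completeness gives the pointwise limit; the explicit rate is recorded because every property of
    [S] is later derived from it by [le0_geometric]. *)
Lemma invsqrt_series_lim : exists S : H -> H, forall x n,
  hnorm ip (poly_act (invsqrt_poly n) x - S x) <= (1 - q)^-1 * hnorm ip x * q ^+ n.
Proof.
apply: (@choice _ _ (fun x l => forall n,
  hnorm ip (poly_act (invsqrt_poly n) x - l) <= (1 - q)^-1 * hnorm ip x * q ^+ n)) => x.
case: ipH => _ _ _ /(_ (fun n => poly_act (invsqrt_poly n) x)) + _ => -[].
  move=> e e0.
  have [N hN] := @geometric_small R q ((1 - q)^-1 * hnorm ip x) e q0 q1 e0.
  exists N => m n Nm Nn; apply: le_lt_trans (hN N (leqnn _)).
  exact: invsqrt_poly_diff_bound.
move=> l hl; exists l => n; apply/ler_addgt0Pr => e e0.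
have [N hN] := hl e e0.
apply: le_trans (hnorm_distD _ (poly_act (invsqrt_poly (maxn n N)) x) _) _.
apply: lerD; last by apply/ltW/hN; rewrite leq_maxr.
by apply: invsqrt_poly_diff_bound; rewrite ?leq_maxl.
Qed.

Lemma invsqrt_op_exists :
  exists S : H -> H, pos_sa_op ip S /\ forall x, S (S (x - C x)) = x.
Proof.
have [S hS] := invsqrt_series_lim.
pose Q n := poly_act (invsqrt_poly n).
have q1' : 0 < 1 - q by rewrite subr_gt0.
set c := (1 - q)^-1 in hS.
have c0 : 0 <= c by rewrite invr_ge0 ltW.
have hS' x n : hnorm ip (S x - Q n x) <= c * hnorm ip x * q ^+ n.
  by rewrite -opprB hnormN; exact: hS.
have Sbd x : hnorm ip (S x) <= c * hnorm ip x.
  have := hS' x 0; rewrite expr0 mulr1 /Q /poly_act.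
  by rewrite (_ : invsqrt_poly 0 = 0) ?size_poly0 ?big_ord0 ?subr0//; apply/polyP => i; rewrite coef_poly coef0.
have Slin (a : R) x y : S (a *: x + y) = a *: S x + S y.
  apply/eqP; rewrite -subr_eq0; apply/eqP/hnorm_eq0.
  apply: (@le0_geometric R q (c * hnorm ip (a *: x + y) + (`|a| * (c * hnorm ip x) + c * hnorm ip y))) => // n.
  have -> : S (a *: x + y) - (a *: S x + S y) =
     (S (a *: x + y) - Q n (a *: x + y)) + (a *: (Q n x - S x) + (Q n y - S y)).
    have -> : Q n (a *: x + y) = a *: Q n x + Q n y by exact: poly_act_lin.
    by rewrite scalerBr [X in _ = _ + X]addrACA -opprD addrA subrK.
  apply: le_trans (hnormD _ _) _; rewrite mulrDl lerD//.
  apply: le_trans (hnormD _ _) _; rewrite mulrDl lerD//.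
    by rewrite hnormZ -[X in _ <= X]mulrA ler_wpM2l//; exact: hS.
  exact: hS.
exists S; split; [split => //|].
- by exists c.
- move=> x y; apply/eqP; rewrite -subr_eq0 -normr_le0.
  apply: (@le0_geometric R q (c * hnorm ip x * hnorm ip y + hnorm ip x * (c * hnorm ip y))) => // n.
  have -> : ip (S x) y - ip x (S y) = ip (S x - Q n x) y + ip x (Q n y - S y).
    by rewrite !ipE poly_act_sym; ring.
  apply: le_trans (ler_normD _ _) _; rewrite mulrDl lerD//.
    by apply: le_trans (ip_CS _ _) _; rewrite mulrAC ler_wpM2r// hnorm_ge0.
  by apply: le_trans (ip_CS _ _) _; rewrite -[X in _ <= X]mulrA ler_wpM2l ?hnorm_ge0//; exact: hS.
- move=> x; rewrite -oppr_le0.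
  apply: (@le0_geometric R q (c * hnorm ip x * hnorm ip x)) => // n.
  have h : 0 <= ip (Q n x) x.
    by apply: poly_act_pos => i; rewrite coef_poly; case: ifP => // _; case/andP: (invsqrt_coef_bounds i).
  have := le_trans (ler_norm _) (ip_CS (Q n x - S x) x); rewrite !ipE => h1.
  have : hnorm ip (Q n x - S x) * hnorm ip x <= c * hnorm ip x * hnorm ip x * q ^+ n.
    by rewrite mulrAC ler_wpM2r ?hnorm_ge0//; exact: hS.
  by move: h h1; lra.
- move=> x; apply/eqP; rewrite -subr_eq0; apply/eqP/hnorm_eq0.
  set z := x - C x.
  apply: (@le0_geometric R q (c * (c * hnorm ip z) + (c * (c * hnorm ip z) + c * hnorm ip x))) => // n.
  (* Three errors of order [q^n]: replacing the outer [S], then the inner one, then the residual of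
     the truncations. The second needs the bound [Qbd], uniform in [n], since [Q n] is applied to an
     error. *)
  have -> : S (S z) - x = (S (S z) - Q n (S z)) + (Q n (S z - Q n z) + (Q n (Q n z) - x)).
    have -> : Q n (S z - Q n z) = Q n (S z) - Q n (Q n z).
      rewrite [S z - _]addrC -[- Q n z]scaleN1r.
      by rewrite [LHS]poly_act_lin scaleN1r addrC.
    by rewrite !addrA !subrK.
  have Qbd u : hnorm ip (Q n u) <= c * hnorm ip u.
    rewrite -[X in _ <= X]mulr1 -(expr0 q); apply: poly_act_bound => // m.
    rewrite coef_poly; case: ifP => _; last by rewrite normr0.
    by case/andP: (invsqrt_coef_bounds m) => h0 h1; rewrite ger0_norm.
  have qn : 0 <= q ^+ n by rewrite exprn_ge0.
  apply: le_trans (hnormD _ _) _; rewrite mulrDl lerD//.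
    by apply: le_trans (hS' _ _) _; rewrite ler_wpM2r// ler_wpM2l.
  apply: le_trans (hnormD _ _) _; rewrite mulrDl lerD//.
    by apply: le_trans (Qbd _) _; rewrite -mulrA ler_wpM2l.
  exact: invsqrt_poly_resid_bound.
Qed.

End PowerSeries.

(** * Inverse and inverse square root of [rho I] plus a sum of rank-one operators *)

Section Resolvent.
Variables (rho : R) (x : nat -> H).
Hypothesis rho0 : 0 < rho.

Definition reg_cov t (y : H) : H :=
  rho *: y + \sum_(1 <= i < t.+1) rank_one ip (x i) (x i) y.

(* The Sherman-Morrison recursion for the inverse of [reg_cov]. *)
Fixpoint resolvent t (y : H) : H :=
  if t is s.+1 then
    let g := resolvent s (x t) in
    resolvent s y - (ip g y / (1 + ip g (x t))) *: g
  else rho^-1 *: y.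

Lemma resolventS t y z : ip (resolvent t.+1 y) z =
  ip (resolvent t y) z - ip (resolvent t (x t.+1)) y * ip (resolvent t (x t.+1)) z
    / (1 + ip (resolvent t (x t.+1)) (x t.+1)).
Proof. by rewrite /= !ipE mulrAC. Qed.

Lemma resolvent_lin t a y z : resolvent t (a *: y + z) = a *: resolvent t y + resolvent t z.
Proof.
elim: t y z => [|t IH] y z /=; first by rewrite scalerDr !scalerA mulrC.
rewrite IH !ipE mulrDl scalerDl scalerBr opprD addrACA; congr (_ - _ + _).
by rewrite scalerA mulrA.
Qed.

Lemma resolvent_sym t y z : ip (resolvent t y) z = ip y (resolvent t z).
Proof.
elim: t y z => [|t IH] y z; first by rewrite /= !ipE.
rewrite resolventS [RHS]ip_sym resolventS; congr (_ - _ / _); last exact: mulrC.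
by rewrite IH ip_sym.
Qed.

Lemma ip_reg_cov t y z : ip (reg_cov t y) z =
  rho * ip y z + \sum_(1 <= i < t.+1) ip (x i) y * ip (x i) z.
Proof.
rewrite /reg_cov !ipE (form_suml _ ip_lin); congr (_ + _).
by apply: eq_bigr => i _; rewrite /rank_one !ipE.
Qed.

Lemma reg_covS t y : reg_cov t.+1 y = reg_cov t y + ip (x t.+1) y *: x t.+1.
Proof. by rewrite /reg_cov big_nat_recr//= addrA. Qed.

Lemma reg_cov_lin t a y z : reg_cov t (a *: y + z) = a *: reg_cov t y + reg_cov t z.
Proof.
rewrite /reg_cov scalerDr [in RHS]scalerDr addrACA !scalerA mulrC; congr (_ + _).
rewrite scaler_sumr -big_split/=; apply: eq_bigr => i _.
by rewrite /rank_one !ipE scalerDl scalerA.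
Qed.

Lemma reg_cov_pos t y : 0 <= ip y (reg_cov t y).
Proof.
rewrite ip_sym ip_reg_cov addr_ge0 ?mulr_ge0 ?ip_ge0 ?(ltW rho0)//.
by apply: sumr_ge0 => i _; rewrite -expr2 sqr_ge0.
Qed.

Lemma reg_cov_resolvent t y : reg_cov t (resolvent t y) = y.
Proof.
elim: t y => [|t IH] y.
  by rewrite /reg_cov /= big_geq// addr0 scalerA divff ?scale1r// gt_eqF.
(* By the inductive hypothesis [x t.+1] is the image of its resolvent under [reg_cov t], so
   positivity of [reg_cov] keeps the Sherman-Morrison denominator at least 1. *)
have k0 : 0 <= ip (resolvent t (x t.+1)) (x t.+1).
  by rewrite -{2}[x t.+1]IH; exact: reg_cov_pos.
have -> : resolvent t.+1 y = (- (ip (resolvent t (x t.+1)) y /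
    (1 + ip (resolvent t (x t.+1)) (x t.+1)))) *: resolvent t (x t.+1) + resolvent t y.
  by rewrite /= scaleNr addrC.
rewrite reg_covS reg_cov_lin !IH.
rewrite [X in X + _]addrC -addrA -scalerDl.
rewrite !ipE -!resolvent_sym.
set k := ip _ (x t.+1); set m := ip _ y.
have k1 : 1 + k != 0 by rewrite gt_eqF// ltr_wpDr.
rewrite (_ : - (m / (1 + k)) + _ = 0) ?scale0r ?addr0//; field.
exact: k1.
Qed.

Lemma resolvent_pos t y : 0 <= ip (resolvent t y) y.
Proof. by rewrite -{2}[y](reg_cov_resolvent t); exact: reg_cov_pos. Qed.

(** Write [T] for [reg_cov t]. The trace-type constant [kap = rho + \sum |x_i|^2] dominates [T],
    while [T >= rho]; so [C = I - T / kap] satisfies [0 <= C <= q] with [q = 1 - rho / kap < 1], and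
    [kap^(-1/2) (I - C)^(-1/2)] is the required root. *)
Lemma invsqrt_reg_cov_exists t : exists S, pos_sa_op ip S /\
  (forall y, S (S (reg_cov t y)) = y) /\ (forall y, reg_cov t (S (S y)) = y).
Proof.
pose sx := \sum_(1 <= i < t.+1) ip (x i) (x i).
have sx0 : 0 <= sx by apply: sumr_ge0 => i _; exact: ip_ge0.
pose kap := rho + sx; have kap0 : 0 < kap by rewrite ltr_wpDr.
pose C y := y - kap^-1 *: reg_cov t y.
pose q := 1 - rho / kap.
have rk : 0 < rho / kap by rewrite divr_gt0.
have rk1 : rho / kap <= 1 by rewrite ler_pdivrMr// mul1r lerDl.
have Cip y z : ip (C y) z =
    ip y z - kap^-1 * (rho * ip y z + \sum_(1 <= i < t.+1) ip (x i) y * ip (x i) z).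
  by rewrite /C (formDl _ ip_lin) (formNl _ ip_lin) (formZl _ ip_lin) ip_reg_cov.
have Clin (a : R) y z : C (a *: y + z) = a *: C y + C z.
  by rewrite /C reg_cov_lin scalerDr opprD addrACA scalerBr !scalerA [kap^-1 * a]mulrC.
have Csym y z : ip (C y) z = ip y (C z).
  rewrite [RHS]ip_sym !Cip (ip_sym z y); congr (_ - _ * (_ + _)).
  by apply: eq_bigr => i _; rewrite mulrC.
have sumCS y : \sum_(1 <= i < t.+1) ip (x i) y * ip (x i) y <= sx * ip y y.
  rewrite mulr_suml; apply: ler_sum => i _; rewrite -expr2.
  exact: (form_CS _ ip_sym ip_lin ip_ge0).
have sum0 y : 0 <= \sum_(1 <= i < t.+1) ip (x i) y * ip (x i) y.
  by apply: sumr_ge0 => i _; rewrite -expr2 sqr_ge0.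
have Cpos y : 0 <= ip (C y) y.
  rewrite Cip subr_ge0 ler_pdivrMl//.
  by rewrite mulrDl lerD2l.
have Cup y : ip (C y) y <= q * ip y y.
  rewrite Cip mulrBl mul1r lerD2l lerN2 [rho / kap]mulrC -mulrA ler_pM2l ?invr_gt0//.
  by rewrite lerDl.
have q0 : 0 <= q by rewrite subr_ge0.
have q1 : q < 1 by rewrite gtrBl.
have Ksym y z : ip (C y) z = ip (C z) y by rewrite Csym ip_sym.
have Klin a y z u : ip (C (a *: y + z)) u = a * ip (C y) u + ip (C z) u.
  by rewrite Clin !ipE.
have Cq y : hnorm ip (C y) <= q * hnorm ip y.
  (* From a bound on the form to a bound on the norm: Cauchy-Schwarz for [<C y, z>] at [z = C y]
     gives [|C y|^4 <= <C y, y> <C C y, C y> <= q^2 |y|^2 |C y|^2]. *)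
  have h := form_CS (fun y z => ip (C y) z) Ksym Klin Cpos y (C y).
  have {}h : ip (C y) (C y) ^+ 2 <= (q ^+ 2 * ip y y) * ip (C y) (C y).
    apply: le_trans h _.
    have -> : q ^+ 2 * ip y y * ip (C y) (C y) = q * ip y y * (q * ip (C y) (C y)) by ring.
    exact: ler_pM.
  apply: hnorm_le; first by rewrite mulr_ge0 ?hnorm_ge0.
  rewrite exprMn sqr_hnorm.
  have := ip_ge0 (C y); rewrite le_eqVlt => /predU1P[<-|c0].
    by rewrite mulr_ge0 ?sqr_ge0 ?ip_ge0.
  by move: h; rewrite expr2 ler_pM2r.
have [S [Spos SS]] := invsqrt_op_exists C q Clin Csym Cpos q0 q1 Cq.
case: Spos => Slin [c Sc] Ssym Spos.
have sk0 : 0 <= Num.sqrt kap^-1 by exact: sqrtr_ge0.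
have SZ a y : S (a *: y) = a *: S y by exact: linopZ.
pose S' y := Num.sqrt kap^-1 *: S y.
have S'E y : S' (S' (reg_cov t y)) = y.
  rewrite /S' !SZ scalerA -expr2 sqr_sqrtr ?invr_ge0 ?(ltW kap0)//.
  by rewrite -!SZ -[RHS]SS /C subKr.
exists S'; split; [split|split => //].
- by move=> a y z; rewrite /S' Slin scalerDr !scalerA mulrC.
- by exists (Num.sqrt kap^-1 * c) => y; rewrite hnormZ ger0_norm// -mulrA ler_wpM2l.
- by move=> y z; rewrite !ipE Ssym.
- by move=> y; rewrite !ipE mulr_ge0.
(* The left inverse is also a right inverse, because every [y] is in the range of [reg_cov t]. *)
- by move=> y; rewrite -{1}[y](reg_cov_resolvent t) S'E reg_cov_resolvent.
Qed.

(** Valid for whichever root [epsilon] picks: [|S y|^2 = <y, S S y>], and writing [y] as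
    [reg_cov t (resolvent t y)] turns [S S y] into [resolvent t y]. From here on the square root can
    be replaced by the recursive resolvent. *)
Lemma inv_sqrt_op_sqr t y :
  hnorm ip (inv_sqrt_op ip (reg_cov t) y) ^+ 2 = ip (resolvent t y) y.
Proof.
have := epsilon_spec (inhabits (fun x : H => x)) _ (invsqrt_reg_cov_exists t).
rewrite -/(inv_sqrt_op ip (reg_cov t)); set S := inv_sqrt_op _ _.
move=> [[_ _ Ssym _] [SS _]].
by rewrite sqr_hnorm Ssym ip_sym -{1}[y](reg_cov_resolvent t) SS.
Qed.

Lemma resolvent_CS t y z :
  ip (resolvent t y) z ^+ 2 <= ip (resolvent t y) y * ip (resolvent t z) z.
Proof.
apply: (form_CS (fun y z => ip (resolvent t y) z)) => [u v|a u v w|u].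
- by rewrite resolvent_sym ip_sym.
- by rewrite resolvent_lin !ipE.
- exact: resolvent_pos.
Qed.

End Resolvent.
End Hilbert.

(** * Hyperbolic functions and the one-step inequality *)

Section Hyperbolic.
Context {R : realType}.
Implicit Types x y z t : R.

Lemma ge0_is_derive_le (f df : R -> R) a b : a <= b ->
  (forall x, is_derive x 1 f (df x)) -> (forall x, a <= x <= b -> 0 <= df x) ->
  f a <= f b.
Proof.
move=> ab fd d0.
have cf : {within `[a, b], continuous f}.
  by apply: derivable_within_continuous => x _; have [] := fd x.
have [c] := MVT_segment ab (fun x _ => fd x) cf.
rewrite in_itv/= => cab e; rewrite -subr_ge0 e mulr_ge0 ?subr_ge0//.
exact: d0.
Qed.

Definition cosh x := (expR x + expR (- x)) / 2.
Definition sinh x := (expR x - expR (- x)) / 2.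

Lemma is_derive_expRM t x : is_derive x 1 (fun y => expR (t * y)) (t * expR (t * x)).
Proof.
by apply: is_derive_eq; rewrite /GRing.scale/= mulr1 mulrC.
Qed.

Lemma is_derive_coshM t x : is_derive x 1 (fun y => cosh (t * y)) (t * sinh (t * x)).
Proof.
have -> : (fun y => cosh (t * y)) =
   (fun y => 2^-1 * (expR (t * y) + expR ((- t) * y))).
  by apply/funext => y; rewrite /cosh mulNr mulrC.
have h1 := is_derive_expRM t x; have h2 := is_derive_expRM (- t) x.
apply: is_derive_eq; rewrite /sinh /GRing.scale/= !mulNr; lra.
Qed.

Lemma is_derive_sinhM t x : is_derive x 1 (fun y => sinh (t * y)) (t * cosh (t * x)).
Proof.
have -> : (fun y => sinh (t * y)) =
   (fun y => 2^-1 * (expR (t * y) - expR ((- t) * y))).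
  by apply/funext => y; rewrite /sinh mulNr mulrC.
have h1 := is_derive_expRM t x; have h2 := is_derive_expRM (- t) x.
apply: is_derive_eq; rewrite /cosh /GRing.scale/= !mulNr; lra.
Qed.

Lemma is_derive_cosh x : is_derive x 1 cosh (sinh x).
Proof.
have := is_derive_coshM 1 x; rewrite !mul1r.
by under eq_fun do rewrite mul1r.
Qed.

Lemma is_derive_sinh x : is_derive x 1 sinh (cosh x).
Proof.
have := is_derive_sinhM 1 x; rewrite !mul1r.
by under eq_fun do rewrite mul1r.
Qed.

Lemma coshN x : cosh (- x) = cosh x.
Proof. by rewrite /cosh opprK addrC. Qed.
Lemma sinhN x : sinh (- x) = - sinh x.
Proof. by rewrite /sinh opprK -mulNr opprB. Qed.
Lemma cosh0 : cosh 0 = 1.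
Proof. by rewrite /cosh oppr0 expR0; lra. Qed.
Lemma sinh0 : sinh 0 = 0.
Proof. by rewrite /sinh oppr0 expR0; lra. Qed.
Lemma cosh_abs x : cosh `|x| = cosh x.
Proof. by case: (ger0P x) => // _; rewrite coshN. Qed.
Lemma coshD x y : cosh (x + y) = cosh x * cosh y + sinh x * sinh y.
Proof. by rewrite /cosh /sinh !opprD !expRD; lra. Qed.
Lemma expR_cosh_sinh x : expR x = cosh x + sinh x.
Proof. by rewrite /cosh /sinh; lra. Qed.
Lemma sinh_ge0 x : 0 <= x -> 0 <= sinh x.
Proof. by move=> x0; rewrite /sinh divr_ge0// subr_ge0 ler_expR; lra. Qed.
Lemma cosh_gt0 x : 0 < cosh x.
Proof. by rewrite /cosh divr_gt0// addr_gt0// expR_gt0. Qed.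
Lemma le_cosh x y : 0 <= x -> x <= y -> cosh x <= cosh y.
Proof.
move=> x0 xy; apply: (@ge0_is_derive_le _ sinh) => // [z|z /andP[xz _]].
  exact: is_derive_cosh.
by rewrite sinh_ge0// (le_trans x0).
Qed.
Lemma cosh_ge1 x : 1 <= cosh x.
Proof. by rewrite -cosh0 -[cosh x]cosh_abs; apply: le_cosh. Qed.
Lemma sinh_le_cosh x : sinh x <= cosh x.
Proof. by rewrite /sinh /cosh; have := expR_gt0 (- x); lra. Qed.
Lemma expR_le_cosh x : expR x <= 2 * cosh x.
Proof. by rewrite /cosh; have := expR_gt0 (- x); lra. Qed.

Lemma sinh_ge_id x : 0 <= x -> x <= sinh x.
Proof.
move=> x0; rewrite -subr_ge0.
have := @ge0_is_derive_le (fun y => sinh y - y) (fun y => cosh y - 1) 0 x x0.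
rewrite sinh0 subr0; apply => [y|y _]; last by rewrite subr_ge0 cosh_ge1.
by have h := is_derive_sinh y; exact: is_derive_eq.
Qed.

(** Monotonicity of [sinh z / z] in a division-free form; this is exactly the convexity of
    [q |-> cosh (sqrt q)]. *)
Lemma sinhM_le t z : 0 <= t -> t <= 1 -> 0 <= z -> sinh (t * z) <= t * sinh z.
Proof.
move=> t0 t1 z0; rewrite -subr_ge0.
have := @ge0_is_derive_le (fun y => t * sinh y - sinh (t * y))
  (fun y => t * cosh y - t * cosh (t * y)) 0 z z0.
rewrite mulr0 sinh0 mulr0 subr0; apply => [y|y /andP[y0 _]].
  have h := is_derive_sinh y; have h' := is_derive_sinhM t y.
  exact: is_derive_eq.
by rewrite -mulrBr mulr_ge0// subr_ge0 le_cosh// ?mulr_ge0// ler_piMl.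
Qed.

Lemma expRM_sub1_le t z : 0 <= t -> t <= 1 -> 0 <= z ->
  expR (t * z) - 1 <= t * (expR z - 1).
Proof.
move=> t0 t1 z0; rewrite -subr_ge0.
have := @ge0_is_derive_le (fun y => t * (expR y - 1) - (expR (t * y) - 1))
  (fun y => t * expR y - t * expR (t * y)) 0 z z0.
rewrite mulr0 expR0 subrr mulr0 subrr; apply => [y|y /andP[y0 _]].
  have h' := is_derive_expRM t y.
  by apply: is_derive_eq; rewrite !oppr0 !addr0.
by rewrite -mulrBr mulr_ge0// subr_ge0 ler_expR ler_piMl.
Qed.

(** Monotonicity of [(exp z - 1 - z) / z^2], as in Bennett's and Freedman's inequalities.
    Differentiating once reduces it to [expRM_sub1_le]. *)
Lemma expRM_sub2_le t z : 0 <= t -> t <= 1 -> 0 <= z ->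
  expR (t * z) - 1 - t * z <= t ^+ 2 * (expR z - 1 - z).
Proof.
move=> t0 t1 z0; rewrite -subr_ge0.
have := @ge0_is_derive_le (fun y => t ^+ 2 * (expR y - 1 - y) - (expR (t * y) - 1 - t * y))
  (fun y => t ^+ 2 * (expR y - 1) - (t * expR (t * y) - t)) 0 z z0.
rewrite mulr0 expR0 !subr0 subrr mulr0 subrr; apply => [y|y /andP[y0 _]].
  have h' := is_derive_expRM t y.
  by apply: is_derive_eq; rewrite !oppr0 !addr0 /GRing.scale/= mulr1.
rewrite subr_ge0 expr2 -mulrA; apply: le_trans (ler_wpM2l t0 (expRM_sub1_le _ _ t0 t1 y0)).
by rewrite mulrBr mulr1.
Qed.

(* The tangent to the convex function [q |-> cosh (sqrt q)] at [x ^+ 2]. *)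
Lemma cosh_sqrt_tangent x y : 0 < x -> 0 <= y ->
  cosh x + (y ^+ 2 - x ^+ 2) * (sinh x / (2 * x)) <= cosh y.
Proof.
(* The claim, multiplied by [2 x], says that [f] is minimal at [x]; the sign of [f'] on either side
   is given by [sinhM_le]. *)
move=> x0 y0; pose f z := 2 * x * cosh z - z ^+ 2 * sinh x.
have fd z : is_derive z 1 f (2 * x * sinh z - 2 * z * sinh x).
  have h := is_derive_cosh z.
  by apply: is_derive_eq; rewrite /GRing.scale/=; ring.
suff : f x <= f y.
  rewrite /f => h.
  have x2 : 0 < 2 * x by rewrite mulr_gt0.
  rewrite -subr_ge0 -(pmulr_rge0 _ x2).
  rewrite [X in 0 <= X](_ : _ = (2 * x * cosh y - y ^+ 2 * sinh x) - (2 * x * cosh x - x ^+ 2 * sinh x)).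
    by rewrite subr_ge0.
  by field; rewrite gt_eqF.
have [xy|yx] := leP x y.
  apply: ge0_is_derive_le xy fd _ => z /andP[xz _].
  have z0 : 0 < z by apply: lt_le_trans xz.
  have := @sinhM_le (x / z) z; rewrite mulfVK ?gt_eqF// => h.
  have {}h : sinh x <= x / z * sinh z.
    by apply: h; rewrite ?divr_ge0 ?ler_pdivrMr ?mul1r// ltW.
  have : z * sinh x <= x * sinh z.
    by rewrite -ler_pdivlMl//; apply: le_trans h _; rewrite mulrAC mulrC.
  lra.
rewrite -lerN2; apply: (@ge0_is_derive_le (- f) (fun z => - (2 * x * sinh z - 2 * z * sinh x)) _ _ (ltW yx)).
move=> z /andP[yz zx]; have z0 : 0 <= z by apply: le_trans yz.
have := @sinhM_le (z / x) x; rewrite mulfVK ?gt_eqF// => h.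
have {}h : sinh z <= z / x * sinh x.
  by apply: h; rewrite ?divr_ge0 ?ler_pdivrMr ?mul1r// ltW.
have : x * sinh z <= z * sinh x.
  by rewrite -ler_pdivlMl//; apply: le_trans h _; rewrite mulrAC mulrC.
lra.
Qed.

(** The argument [q] of the root is the mean of [(a + r)^2] and [(a - r)^2] with weights
    [(1 + c) / 2] and [(1 - c) / 2]. Averaging the tangent inequality at [sqrt q] with these weights
    cancels the slope, and the right side is the same mean of [cosh (a + r)] and [cosh (a - r)]. *)
Lemma cosh_sqrt_interpolation a r c : -1 <= c <= 1 ->
  cosh (Num.sqrt (a ^+ 2 + 2 * (a * r * c) + r ^+ 2))
  <= cosh a * cosh r + c * (sinh a * sinh r).
Proof.
move=> /andP[c1 c2]; set q := _ + r ^+ 2.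
have := cosh_ge1 (a + r); have := cosh_ge1 (a - r).
have := cosh_abs (a - r); have := cosh_abs (a + r).
rewrite -[a - r]/(a + - r) !coshD coshN sinhN mulrN => e1 e2 g1 g2.
(* The tangent is available only at a positive point; otherwise the left side is [cosh 0 = 1], below
   a weighted mean of values of [cosh]. *)
have [q0|q0] := leP q 0; first by rewrite ler0_sqrtr// cosh0; nra.
have x0 : 0 < Num.sqrt q by rewrite sqrtr_gt0.
have t1 := @cosh_sqrt_tangent (Num.sqrt q) `|a + r| x0 (normr_ge0 _).
have t2 := @cosh_sqrt_tangent (Num.sqrt q) `|a - r| x0 (normr_ge0 _).
move: t1 t2; rewrite !real_normK ?num_real// sqr_sqrtr ?(ltW q0)// e1 e2.
set k := sinh _ / _.
have -> : (a + r) ^+ 2 - q = 2 * (a * r) * (1 - c) by rewrite /q; ring.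
have -> : (a - r) ^+ 2 - q = - (2 * (a * r) * (1 + c)) by rewrite /q; ring.
set m := 2 * (a * r).
move: (cosh (Num.sqrt q)) (cosh a * cosh r) (sinh a * sinh r) => C u v t1 t2.
have h1 : (1 + c) * (C + m * (1 - c) * k) <= (1 + c) * (u + v) by rewrite ler_wpM2l//; lra.
have h2 : (1 - c) * (C + - (m * (1 + c)) * k) <= (1 - c) * (u - v) by rewrite ler_wpM2l//; lra.
by move: h1 h2; lra.
Qed.

(** Isolates a term linear in [r], hence in the noise, which will have zero conditional mean. For
    [r >= 0] the gap between the two sides is [(cosh a - c sinh a) (sinh r - r)]. *)
Lemma cosh_interpolation_le a r c : 0 <= a -> -1 <= c <= 1 ->
  cosh a * cosh r + c * (sinh a * sinh r)
  <= cosh a * (expR `|r| - `|r|) + r * c * sinh a.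
Proof.
move=> a0.
wlog r0 : r c / 0 <= r => [hw c1|].
  have [r0|r0] := leP 0 r; first exact: hw.
  have := hw (- r) (- c); rewrite oppr_ge0 (ltW r0) coshN sinhN normrN.
  move=> /(_ isT); rewrite lerNl opprK lerNl andbC => /(_ c1).
  by rewrite mulrNN !mulrN !mulNr opprK.
move=> /andP[c1 c2]; rewrite ger0_norm// expR_cosh_sinh.
have s0 := sinh_ge_id r r0; have := sinh_le_cosh a; have := sinh_ge0 a a0.
move=> sa sc.
have h : 0 <= sinh r - r by rewrite subr_ge0.
have : c * sinh a * (sinh r - r) <= cosh a * (sinh r - r).
  by rewrite ler_wpM2r//; nra.
lra.
Qed.

(* Pinelis' one-step inequality for [cosh] of the norm of [y + eps *: v], where
   [A], [b], [g] stand for |y|^2, <y, v>, |v|^2; at [A = 0] the division by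
   [sqrt A] is harmless since then [b = 0]. *)
Lemma cosh_one_step A b g eps B lam : 0 <= A -> 0 <= g <= 1 -> b ^+ 2 <= A * g ->
  0 < B -> `|eps| <= B -> 0 <= lam ->
  cosh (lam * Num.sqrt (A + 2 * eps * b + eps ^+ 2 * g)) <=
  cosh (lam * Num.sqrt A) *
    (1 + (expR (lam * B) - 1 - lam * B) / B ^+ 2 * (g * eps ^+ 2)) +
  eps * (lam * b * sinh (lam * Num.sqrt A) / Num.sqrt A).
Proof.
move=> A0 /andP[g0 g1] bAg B0 eB l0.
pose a := lam * Num.sqrt A; pose r := lam * eps * Num.sqrt g.
pose c := b / (Num.sqrt A * Num.sqrt g).
have sA := sqr_sqrtr A0; have sg := sqr_sqrtr g0.
have sA0 := sqrtr_ge0 A; have sg0 := sqrtr_ge0 g.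
(* If [A g = 0] the quotient [c] is 0 by convention, and [b] vanishes as well since [b^2 <= A g]. *)
have bE : b = c * (Num.sqrt A * Num.sqrt g).
  rewrite /c; have [/eqP z|nz] := boolP (Num.sqrt A * Num.sqrt g == 0); last by rewrite mulfVK.
  rewrite z mulr0; apply/eqP; rewrite -sqrf_eq0 eq_le sqr_ge0 andbT.
  by rewrite (le_trans bAg)// -sA -sg -exprMn z expr0n.
have c1 : -1 <= c <= 1.
  rewrite -ler_norml /c normrM normfV.
  have [/eqP ->|nz] := boolP (Num.sqrt A * Num.sqrt g == 0).
    by rewrite normr0 invr0 mulr0.
  have p : 0 < Num.sqrt A * Num.sqrt g by rewrite lt0r nz mulr_ge0.
  rewrite ler_pdivrMr ?normr_gt0// mul1r -(@ler_pXn2r _ 2)// ?nnegrE//.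
  by rewrite !real_normK ?num_real// exprMn sA sg.
have lam2 : lam ^+ 2 * (A + 2 * eps * b + eps ^+ 2 * g) = a ^+ 2 + 2 * (a * r * c) + r ^+ 2.
  by rewrite /a /r !exprMn sA sg {1}bE; ring.
have -> : lam * Num.sqrt (A + 2 * eps * b + eps ^+ 2 * g)
        = Num.sqrt (a ^+ 2 + 2 * (a * r * c) + r ^+ 2).
  by rewrite -lam2 sqrtrM ?sqr_ge0// sqrtr_sqr ger0_norm.
apply: le_trans (cosh_sqrt_interpolation _ _ _ c1) _.
have a0 : 0 <= a by rewrite mulr_ge0.
apply: le_trans (cosh_interpolation_le _ _ _ a0 c1) _.
rewrite -/a lerD//; last first.
  have [/eqP z|nz] := boolP (Num.sqrt A == 0).
    by rewrite /a z mulr0 sinh0 !mulr0 !mul0r mulr0.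
  suff -> : r * c * sinh a = eps * (lam * b * sinh a / Num.sqrt A) by [].
  by rewrite /r {1}bE; field.
rewrite ler_pM2l ?cosh_gt0//.
have [/eqP l00|ln0] := boolP (lam == 0).
  by rewrite /r l00 !mul0r normr0 expR0 !subr0 subrr mul0r mul0r addr0.
have lp : 0 < lam by rewrite lt0r ln0.
(* The fraction [t <= 1] with [|r| = t (lam B)]; its square supplies the factor [g eps^2 / B^2]
   through [expRM_sub2_le]. *)
pose t := `|eps| * Num.sqrt g / B.
have t0 : 0 <= t by rewrite divr_ge0 ?mulr_ge0// ltW.
have t1 : t <= 1.
  rewrite ler_pdivrMr// mul1r (le_trans _ eB)// ler_piMr//.
  by rewrite -(@ler_pXn2r _ 2)// ?nnegrE// sg expr1n.
have -> : `|r| = t * (lam * B).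
  rewrite /r !normrM (ger0_norm l0) (ger0_norm sg0) /t; field.
  by rewrite gt_eqF.
have := @expRM_sub2_le t (lam * B) t0 t1 (mulr_ge0 l0 (ltW B0)).
have -> : t ^+ 2 = (g * eps ^+ 2) / B ^+ 2.
  by rewrite /t !exprMn sg real_normK ?num_real// exprVn [g * _]mulrC.
lra.
Qed.

End Hyperbolic.

(** * Sub-sigma-algebras and Ville's inequality *)

Section SubSigma.
Context {R : realType} {d : measure_display} {Omega : measurableType d}.
Implicit Types G : set (set Omega).

(** Measurability for a sub-sigma-algebra is expressed by changing the structure on the domain, so
    that the closure properties of [measurable_fun] apply to each [F t] directly. *)
Definition adapted {d' : measure_display} {T : measurableType d'} G (f : Omega -> T) :=
  measurable_fun [set: g_sigma_algebraType G] (f : g_sigma_algebraType G -> T).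

Lemma sub_sigmaE G (A : set Omega) : sub_sigma G ->
  @measurable _ (g_sigma_algebraType G) A = G A.
Proof. by case=> sG _; rewrite measurable_g_measurableTypeE. Qed.

Lemma Gmeas_adapted G (f : Omega -> R) : sub_sigma G -> Gmeas_R G f -> adapted G f.
Proof. by move=> sG fG _ U mU; rewrite setTI sub_sigmaE//; exact: fG. Qed.

Lemma adapted_preimage d' (T : measurableType d') G (f : Omega -> T) U : sub_sigma G ->
  adapted G f -> measurable U -> G (f @^-1` U).
Proof. by move=> sG fG mU; rewrite -sub_sigmaE// -[X in measurable X]setTI; exact: fG. Qed.

Lemma adapted_le d' (T : measurableType d') G G' (f : Omega -> T) :
  sub_sigma G -> sub_sigma G' -> G `<=` G' -> adapted G f -> adapted G' f.
Proof.
move=> sG sG' GG' fG _ U mU; rewrite setTI sub_sigmaE//; apply: GG'.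
exact: adapted_preimage.
Qed.

Lemma adapted_measurable d' (T : measurableType d') G (f : Omega -> T) :
  sub_sigma G -> adapted G f -> measurable_fun [set: Omega] f.
Proof.
move=> sG fG _ U mU; rewrite setTI; case: (sG) => _; apply.
exact: adapted_preimage.
Qed.

(** [Gmeas_H] only gives preimages of open sets, one variable at a time. By continuity and
    separability, the set where [<f, g>] exceeds [r] is a countable union of intersections of
    preimages of balls around points of the dense sequence. *)
Lemma adapted_ip {H : lmodType R} (ip : H -> H -> R) G (f g : Omega -> H) :
  real_separable_hilbert ip -> sub_sigma G -> Gmeas_H ip G f -> Gmeas_H ip G g ->
  adapted G (fun w => ip (f w) (g w)).
Proof.
move=> ipH sG mf mg.
case: (ipH) => _ _ _ _ [den hden].
have ball_open (c : H) (e : R) : hopen ip [set x | hnorm ip (x - c) < e].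
  move=> x /= xc; exists (e - hnorm ip (x - c)); first by rewrite subr_gt0.
  move=> y yx; apply: le_lt_trans (hnorm_distD ip ipH _ x _) _.
  by rewrite -ltrBrDr.
pose e k : R := k.+1%:R^-1.
pose good r n m k := forall x y, hnorm ip (x - den n) < e k ->
  hnorm ip (y - den m) < e k -> r < ip x y.
apply: (@measurability _ _ (g_sigma_algebraType G) R setT _ (@RGenOInfty.G R)).
  exact: RGenOInfty.measurableE.
move=> _ [_ [r ->] <-]; rewrite setTI.
have -> : (fun w => ip (f w) (g w)) @^-1` `]r, +oo[ =
  \bigcup_n \bigcup_m \bigcup_k
    ((f @^-1` [set x | hnorm ip (x - den n) < e k]) `&`
     (g @^-1` [set x | hnorm ip (x - den m) < e k]) `&` [set _ | good r n m k]).
  apply/seteqP; split => w /=; last first.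
    by move=> [n _ [m _ [k _ [[h1 h2] h3]]]]; rewrite in_itv/= andbT; exact: h3.
  rewrite in_itv/= andbT => rw; set x := f w in rw *; set y := g w in rw *.
  pose L := hnorm ip x + hnorm ip y + 1.
  have x0 := hnorm_ge0 ip x; have y0 := hnorm_ge0 ip y.
  have L0 : 0 < L by rewrite /L; lra.
  (* Points of the two balls lie within [2 e k] of [x] and [y]. The first bound on [e k] gives
     [|y'| <= |y| + 1], so the scalar product moves by at most [2 e k L]; the second keeps this
     below [ip x y - r]. *)
  pose eta := Num.min 2^-1 ((ip x y - r) / (2 * L)).
  have eta0 : 0 < eta by rewrite lt_min invr_gt0 ltr0n/= divr_gt0 ?subr_gt0 ?mulr_gt0.
  have [k ke] : exists k, e k < eta.
    have := @cvg_harmonic R => /cvgrPdist_lt /(_ _ eta0) [N _ /(_ N (leqnn _))] /=.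
    by rewrite sub0r normrN ger0_norm ?invr_ge0// => h; exists N.
  have ek0 : 0 < e k by rewrite invr_gt0.
  have [n xn] := hden x _ ek0; have [m ym] := hden y _ ek0.
  exists n => //; exists m => //; exists k => //; split; first by split.
  move=> x' y' x'n y'm.
  have hx : hnorm ip (x' - x) <= 2 * e k.
    apply: le_trans (hnorm_distD ip ipH _ (den n) _) _.
    by rewrite -[den n - x]opprB (hnormN ip ipH); lra.
  have hy : hnorm ip (y' - y) <= 2 * e k.
    apply: le_trans (hnorm_distD ip ipH _ (den m) _) _.
    by rewrite -[den m - y]opprB (hnormN ip ipH); lra.
  have e12 : 2 * e k < 1.
    by have : e k < 2^-1 by [apply: lt_le_trans ke _; rewrite ge_min lexx]; lra.
  have e2 : 2 * e k * L < ip x y - r.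
    have : e k < (ip x y - r) / (2 * L) by apply: lt_le_trans ke _; rewrite ge_min lexx orbT.
    by rewrite ltr_pdivlMr ?mulr_gt0//; lra.
  have hy' : hnorm ip y' <= hnorm ip y + 1.
    by rewrite -[y'](subrK y); apply: le_trans (hnormD ip ipH _ _) _; lra.
  have h1 := ip_CS ip ipH (x' - x) y'.
  have h2 := ip_CS ip ipH x (y' - y).
  have h1' : hnorm ip (x' - x) * hnorm ip y' <= 2 * e k * (hnorm ip y + 1).
    by apply: ler_pM => //; exact: hnorm_ge0.
  have h2' : hnorm ip x * hnorm ip (y' - y) <= hnorm ip x * (2 * e k).
    by rewrite ler_wpM2l.
  have E : ip x' y' = ip x y + (ip (x' - x) y' + ip x (y' - y)).
    rewrite (formDl _ (ip_lin ip ipH)) (formNl _ (ip_lin ip ipH)).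
    by rewrite (formDr _ (ip_sym ip ipH) (ip_lin ip ipH)) (formNr _ (ip_sym ip ipH) (ip_lin ip ipH)); ring.
  move: h1 h2; rewrite !ler_norml E => /andP[h1 _] /andP[h2 _].
  by move: e2; rewrite /L; lra.
apply: bigcupT_measurable => n; apply: bigcupT_measurable => m.
apply: bigcupT_measurable => k.
(* The condition [good] does not involve [w]: the last factor is the whole space or empty. *)
have [gd|ngd] := pselect (good r n m k); last first.
  rewrite (_ : _ `&` _ = set0); first exact: measurable0.
  by rewrite -subset0 => w [_ /=].
rewrite [X in _ `&` X](_ : _ = setT); last by apply/seteqP; split.
rewrite setIT; apply: measurableI; rewrite sub_sigmaE//.
  exact: mf (ball_open _ _).
exact: mg (ball_open _ _).
Qed.

Variable P : probability Omega R.
Local Open Scope ereal_scope.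

(** Tonelli for the function equal to [Y w] on [0 <= u < W w] and 0 elsewhere: integrating first in
    [u] yields [W w * Y w]. *)
Lemma integral_layer_cake (W Y : Omega -> R) :
  measurable_fun setT W -> measurable_fun setT Y ->
  (forall w, 0 <= W w)%R -> (forall w, 0 <= Y w)%R ->
  \int[P]_w (W w * Y w)%:E =
  \int[@lebesgue_measure R]_(u in `[0%R, +oo[) \int[P]_(w in [set w | (u < W w)%R]) (Y w)%:E.
Proof.
move=> mW mY W0 Y0.
pose f (z : Omega * R) : \bar R :=
  (if (0 <= z.2)%R && (z.2 < W z.1)%R then Y z.1 else 0%R)%:E.
have mf : measurable_fun setT f.
  apply/measurable_EFinP; apply: measurable_fun_ifT => //.
  - apply: measurable_and.
      apply: measurable_fun_ler => //; exact: measurable_snd.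
    apply: measurable_fun_ltr; first exact: measurable_snd.
    exact: measurableT_comp measurable_fst.
  - exact: measurableT_comp measurable_fst.
have f0 z : 0 <= f z by rewrite /f lee_fin; case: ifP.
have := @fubini_tonelli _ _ _ _ _ P (@lebesgue_measure R) f mf f0.
rewrite [LHS](_ : _ = \int[P]_w (W w * Y w)%:E); last first.
  apply: eq_integral => w _; rewrite /f /=.
  under eq_integral => u _.
    rewrite (_ : (if _ then _ else _)%:E = (Y w)%:E * (\1_(`[0%R, W w[%classic) u)%:E); last first.
      rewrite indicE/= mem_setE in_itv/=; case: ifP => _; first by rewrite mule1.
      by rewrite mule0.
    over.
  rewrite ge0_integralZl//; last 2 first.
  - by apply/measurable_EFinP; exact: measurable_indic.
  - by rewrite lee_fin.
  transitivity ((Y w)%:E * lebesgue_measure `[0%R, W w[%classic).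
    by congr (_ * _); rewrite integral_indic// setIT.
  rewrite lebesgue_measure_itv/= lte_fin.
  case: ltP => [_|Ww]; first by rewrite oppr0 adde0 -EFinM mulrC.
  by rewrite mule0 (_ : W w = 0%R) ?mul0r//; apply/eqP; rewrite eq_le Ww W0.
move=> ->; rewrite [RHS]integral_mkcond; apply: eq_integral => u _.
rewrite patchE mem_setE in_itv/= andbT.
case: ifPn => u0; last first.
  by rewrite /f /= (negbTE u0)/= integral0.
rewrite [RHS]integral_mkcond; apply: eq_integral => w _.
rewrite /f/= u0/= patchE; case: ifPn => h; first by rewrite mem_set.
by rewrite memNset//=; apply/negP.
Qed.

(** Taking out a known factor: the hypothesis says that [Y] has conditional mean [c], and it applies
    to each layer [u < W], which belongs to [G]. Nonnegativity allows [W] to have infinite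
    integral. *)
Lemma integral_cond_const G (W Y : Omega -> R) (c : R) : sub_sigma G ->
  adapted G W -> measurable_fun setT Y ->
  (forall w, 0 <= W w)%R -> (forall w, 0 <= Y w)%R -> (0 <= c)%R ->
  (forall A, G A -> \int[P]_(w in A) (Y w)%:E = c%:E * P A) ->
  \int[P]_w (W w * Y w)%:E = c%:E * \int[P]_w (W w)%:E.
Proof.
move=> sG aW mY W0 Y0 c0 hY.
have mW := adapted_measurable _ _ _ _ sG aW.
have lev u : G [set w | (u < W w)%R].
  have := adapted_preimage _ _ _ _ `]u, +oo[%classic sG aW.
  have -> : W @^-1` `]u, +oo[ = [set w | (u < W w)%R].
    by apply/seteqP; split => w; rewrite /= in_itv/= andbT.
  by apply.
have mlev u : measurable [set w | (u < W w)%R] by case: (sG) => _; apply.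
rewrite integral_layer_cake//.
under [in RHS]eq_integral => w _ do rewrite -[W w]mulr1.
rewrite (integral_layer_cake W (fun=> 1%R))//.
under eq_integral => u _ do rewrite hY//.
under [in RHS]eq_integral => u _.
  rewrite integral_cst// mul1e; over.
rewrite ge0_integralZl//.
(* What remains is measurability in [u] of the probability of the layer, a section of the measurable
   set of pairs with [u < W w]. *)
apply: measurable_funTS.
pose A : set (R * Omega) := [set z | (z.1 < W z.2)%R].
have mA : measurable A.
  have h : measurable_fun setT (fun z : R * Omega => (z.1 < W z.2)%R).
    apply: measurable_fun_ltr; first exact: measurable_fst.
    exact: measurableT_comp measurable_snd.
  have := h measurableT [set true] I; rewrite setTI => {}h.
  by rewrite /A (_ : [set z | _] = (fun z : R * Omega => (z.1 < W z.2)%R) @^-1` [set true]).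
have := @measurable_fun_xsection _ _ R Omega R P A mA.
rewrite (_ : P \o xsection A = fun u => P [set w | (u < W w)%R])//.
by apply/funext => u /=; congr (P _); apply/seteqP; split => w; rewrite /xsection/= in_setE.
Qed.

(** * Ville's maximal inequality for nonnegative, possibly infinite, supermartingales *)

Section Ville.
Variable F : nat -> set (set Omega).
Hypothesis fF : filtration F.
Variable N : nat -> Omega -> \bar R.
Hypothesis N0 : forall t w, 0 <= N t w.
Hypothesis aN : forall t, adapted (F t) (N t).
Hypothesis superN : forall t A, F t A -> \int[P]_(w in A) N t.+1 w <= \int[P]_(w in A) N t w.
Hypothesis initN : \int[P]_w N 0 w <= 1.

Let sF t : sub_sigma (F t). Proof. by case: fF. Qed.

Fixpoint below (c : R) n : set Omega :=
  if n is m.+1 then below c m `&` [set w | N n w < c%:E] else [set w | N 0 w < c%:E].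

Lemma adapted_lt t (c : \bar R) : F t [set w | N t w < c].
Proof.
rewrite -sub_sigmaE//; have := @emeasurable_fun_infty_o _ _ _ _ _ measurableT (aN t) c.
by rewrite setTI.
Qed.

Lemma below_sigma c n : F n (below c n).
Proof.
elim: n => [|n IH]; first exact: adapted_lt.
rewrite -sub_sigmaE//; apply: measurableI; rewrite sub_sigmaE//; last exact: adapted_lt.
by case: fF => _ /(_ n n.+1 (leqnSn _)); apply.
Qed.

Let mF t A : F t A -> measurable A.
Proof. by case: (sF t) => _; apply. Qed.

Let mN t : measurable_fun setT (N t).
Proof. exact: adapted_measurable (sF t) (aN t). Qed.

(** Markov's inequality on the part of [A] where level [c] is reached at time [n], keeping the
    integral over the rest. *)
Lemma ville_split c n (A : set Omega) : (0 <= c)%R -> measurable A ->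
  c%:E * P (A `\` [set w | N n w < c%:E]) +
    \int[P]_(w in A `&` [set w | N n w < c%:E]) N n w <= \int[P]_(w in A) N n w.
Proof.
move=> c0 mA; have mB := mF _ _ (adapted_lt n c%:E).
have mD : measurable (A `\` [set w | N n w < c%:E]) by exact: measurableD.
rewrite -[in X in _ <= X](setUIDK A [set w | N n w < c%:E]) setUC.
rewrite ge0_integral_setU//; last 3 first.
- exact: measurableI.
- exact: measurable_funTS.
- by rewrite disj_set2E; apply/eqP/seteqP; split => // w [[_ h] [_ /=]].
rewrite leeD2r// -integral_cst//; apply: ge0_le_integral => //.
- exact: measurable_funTS.
- by move=> w [_ /= /negP]; rewrite -leNgt.
Qed.

(** Optional stopping as an invariant: paths that have reached [c] are frozen at value [c], the
    others still carry [N n], and the total never increases. *)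
Lemma ville_finite c n : (0 <= c)%R ->
  c%:E * P (~` below c n) + \int[P]_(w in below c n) N n w <= 1.
Proof.
move=> c0; elim: n => [|n IH].
  apply: le_trans initN; have := ville_split c 0 setT c0 measurableT.
  by rewrite setTI setTD.
apply: le_trans IH; have mb := mF _ _ (below_sigma c n).
apply: (@le_trans _ _ (c%:E * P (~` below c n) + \int[P]_(w in below c n) N n.+1 w)); last first.
  by rewrite leeD2l// superN//; exact: below_sigma.
apply: le_trans (leeD2l _ (ville_split c n.+1 (below c n) c0 mb)).
rewrite [X in _ <= X]addeA; apply: leeD; last by [].
have -> : c%:E * P (~` below c n) + c%:E * P (below c n `\` [set w | N n.+1 w < c%:E]) =
    c%:E * (P (~` below c n) + P (below c n `\` [set w | N n.+1 w < c%:E])).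
  by rewrite ge0_muleDr.
rewrite lee_wpmul2l ?lee_fin//.
have mD : measurable (below c n `\` [set w | N n.+1 w < c%:E]).
  by apply: measurableD => //; exact: mF (adapted_lt _ _).
rewrite -measureU//; last 2 first.
- exact: measurableC.
- by apply/seteqP; split => // w [h [/h]].
rewrite le_measure ?inE//.
- by apply/measurableC/measurableI => //; exact: mF (adapted_lt _ _).
- by apply: measurableU => //; exact: measurableC.
move=> w /= h; have [bw|] := pselect (below c n w); last by left.
by right; split => // h'; apply: h.
Qed.

Lemma ville c : (0 < c)%R -> P [set w | exists t, c%:E <= N t w] <= (c^-1)%:E.
Proof.
move=> c0.
have mb n : measurable (~` below c n) by apply/measurableC; exact: mF (below_sigma _ _).
have -> : [set w | exists t, c%:E <= N t w] = \bigcup_n ~` below c n.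
  apply/seteqP; split => w /=.
    move=> [t ct]; exists t => //; case: t ct => [|t] ct /=; first by rewrite ltNge ct.
    by move=> [_]; rewrite ltNge ct.
  move=> [n _]; elim: n => [|n IH] /=.
    by move/negP; rewrite -leNgt => ?; exists 0%N.
  move=> h; have [bw|/IH//] := pselect (below c n w).
  exists n.+1; rewrite leNgt; apply/negP => h'; exact: h.
have nd : nondecreasing_seq (fun n => ~` below c n).
  apply/nondecreasing_seqP => n; apply/subsetPset => w /= h [h' _]; exact: h.
have cv := @nondecreasing_cvg_mu _ _ _ P _ mb (bigcupT_measurable _ mb) nd.
rewrite -(cvg_lim _ cv)//; apply: lime_le; first by apply/cvg_ex; eexists; exact: cv.
apply: nearW => n /=; have := ville_finite c n (ltW c0) => h.
have {}h : c%:E * P (~` below c n) <= 1.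
  by apply: le_trans h; rewrite leeDl// integral_ge0.
by rewrite -(@lee_pmul2l _ c%:E)// ?lte_fin// -EFinM divff ?gt_eqF.
Qed.

(** A supremum of at least [delta^-1] need not be attained, so [ville] is applied at the strictly
    lower level [(delta + e)^-1] and [e] tends to 0. *)
Lemma ville_sup delta : (0 < delta)%R ->
  P [set w | (delta^-1)%:E <= ereal_sup (range (N^~ w))] <= delta%:E.
Proof.
move=> d0.
apply/lee_addgt0Pr => e e0.
have c0 : (0 < (delta + e)^-1)%R by rewrite invr_gt0 addr_gt0.
rewrite -EFinD -[(delta + e)%R]invrK; apply: le_trans (ville _ c0).
have msup : measurable_fun setT (fun w => ereal_sup (range (N^~ w))).
  have := @measurable_fun_esups _ _ _ setT N mN 0%N.
  apply: eq_measurable_fun => w _; rewrite /esups; congr ereal_sup.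
  by apply/seteqP; split => [_ [n _ <-]|_ [n _ <-]]; exists n.
rewrite le_measure// ?inE.
- by have := emeasurable_fun_c_infty measurableT msup (delta^-1)%:E; rewrite setTI.
- have -> : [set w | exists t, ((delta + e)^-1)%:E <= N t w] =
      \bigcup_t [set w | ((delta + e)^-1)%:E <= N t w].
    by apply/seteqP; split => w [t]; exists t.
  apply: bigcupT_measurable => t.
  by have := emeasurable_fun_c_infty measurableT (mN t) ((delta + e)^-1)%:E; rewrite setTI.
move=> w /= h; apply: contrapT => /forallNP h'.
have : ereal_sup (range (N^~ w)) <= ((delta + e)^-1)%:E.
  apply: ub_ereal_sup => _ [t _ <-]; rewrite leNgt; apply/negP => /ltW; exact: h'.
move/(le_trans h); rewrite lee_fin leNgt ltf_pV2 ?posrE ?addr_gt0//.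
by rewrite ltrDl e0.
Qed.

End Ville.
End SubSigma.

(** * The supermartingale and its mixture *)

Section MeasurableReal.
Context {R : realType} {d : measure_display} {T : measurableType d}.
Implicit Types f g : T -> R.

Lemma measurable_sqrt f : measurable_fun setT f ->
  measurable_fun setT (fun z => Num.sqrt (f z)).
Proof.
by move=> mf; apply: measurableT_comp mf; apply: continuous_measurable_fun; exact: sqrt_continuous.
Qed.

Lemma measurable_inv f : measurable_fun setT f -> measurable_fun setT (fun z => (f z)^-1).
Proof.
move=> mf.
(* The identity also holds at a zero of [f], where both sides are 0. *)
have -> : (fun z => (f z)^-1) = (fun z => f z * powR (f z ^+ 2) (-1)).
  apply/funext => z; rewrite powR_inv1 ?sqr_ge0//.
  have [->|nz] := eqVneq (f z) 0; first by rewrite invr0 mul0r.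
  by field.
apply: measurable_funM => //.
exact: (measurableT_comp (measurable_powR (-1)) (measurable_funX 2 mf)).
Qed.

Lemma measurable_expR_comp f : measurable_fun setT f ->
  measurable_fun setT (fun z => expR (f z)).
Proof. by move=> mf; exact: measurableT_comp. Qed.

Lemma measurable_cosh f : measurable_fun setT f -> measurable_fun setT (fun z => cosh (f z)).
Proof.
move=> mf; apply: measurable_funM => //; apply: measurable_funD; apply: measurable_expR_comp => //.
exact: measurable_funN.
Qed.

Lemma measurable_sinh f : measurable_fun setT f -> measurable_fun setT (fun z => sinh (f z)).
Proof.
move=> mf; apply: measurable_funM => //; apply: measurable_funB; apply: measurable_expR_comp => //.
exact: measurable_funN.
Qed.
End MeasurableReal.

(** [is_condvar] centres [Y] at some version [Z] of its conditional mean. Since 0 is a version too,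
    [Z] integrates to 0 over [Z >= 0] and over [Z < 0], both in [G]; hence [Z = 0] almost
    everywhere. *)
Lemma condvar_sqr (R : realType) (d : measure_display) (Omega : measurableType d)
    (P : probability Omega R) (G : set (set Omega)) (Y V : Omega -> R) A :
  sub_sigma G -> is_condexp P G Y (fun=> 0) -> is_condvar P G Y V -> G A ->
  (\int[P]_(w in A) (Y w ^+ 2)%:E = \int[P]_(w in A) (V w)%:E)%E.
Proof.
move=> sG [iY _ _ Y0] [Z [[_ mZ iZ YZ] [_ _ _ hV]]] GA.
have mG B : G B -> measurable B by case: sG => _; apply.
have aZ := Gmeas_adapted _ _ sG mZ.
have mZ' := adapted_measurable _ _ _ _ sG aZ.
have mY : measurable_fun setT Y by apply/measurable_EFinP; exact: measurable_int iY.
have Z0 B : G B -> (\int[P]_(w in B) (Z w)%:E = 0)%E.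
  by move=> GB; rewrite -YZ// Y0// integral0.
pose Bp := [set w | 0 <= Z w]; pose Bn := [set w | Z w < 0].
have GBp : G Bp.
  have := mZ `[0, +oo[%classic (measurable_itv _).
  by rewrite (_ : _ @^-1` _ = Bp)//; apply/seteqP; split => w; rewrite /= in_itv/= andbT.
have GBn : G Bn.
  have := mZ `]-oo, 0[%classic (measurable_itv _).
  by rewrite (_ : _ @^-1` _ = Bn)//; apply/seteqP; split => w; rewrite /= in_itv/=.
have absZ : (\int[P]_w `|(Z w)%:E| = 0)%E.
  have -> : [set: Omega] = Bp `|` Bn.
    apply/seteqP; split => w //= _; rewrite /Bp /Bn /=.
    by case: (leP 0 (Z w)); [left|right].
  rewrite ge0_integral_setU//; last 4 first.
  - exact: mG.
  - exact: mG.
  - apply: measurableT_comp => //; apply: measurable_funTS; exact/measurable_EFinP.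
  - rewrite disj_set2E; apply/eqP/seteqP; split => // w []; rewrite /Bp /Bn /=.
    by rewrite leNgt => /negP.
  rewrite (@eq_integral _ _ _ P Bp (fun w => (Z w)%:E)); last first.
    by move=> w; rewrite inE => /= h; rewrite ger0_norm.
  rewrite (@eq_integral _ _ _ P Bn (fun w => ((-1)%:E * (Z w)%:E)%E)); last first.
    by move=> w; rewrite inE => /= h; rewrite ltr0_norm// -EFinM mulN1r.
  rewrite integralZl//; last 2 first.
  - exact: mG.
  - by apply: integrableS iZ => //; exact: mG.
  by rewrite !Z0// mule0 adde0.
have aeZ : ae_eq P setT (EFin \o Z) (cst 0%E).
  by apply/ae_eq_integral_abs => //; exact/measurable_EFinP.
rewrite -hV//; apply: ae_eq_integral.
- exact: mG.
- by apply: measurable_funTS; apply/measurable_EFinP; exact: measurable_funX.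
- by apply: measurable_funTS; apply/measurable_EFinP; apply: measurable_funX; exact: measurable_funB.
- move: aeZ; apply: filterS => w /= /(_ I) [zw] _.
  by rewrite zw subr0.
Qed.

(** * The self-normalised process, the one-parameter supermartingales and their mixture *)

Section Process.
Context {R : realType} {H : lmodType R} (ip : H -> H -> R)
  {d : measure_display} {Omega : measurableType d} (P : probability Omega R)
  (F : nat -> set (set Omega)) (X : nat -> Omega -> H) (eps : nat -> Omega -> R)
  (B sigma2 rho : R).
Hypothesis ipH : real_separable_hilbert ip.
Hypothesis fF : filtration F.
Hypothesis mX : forall t, (1 <= t)%N -> Gmeas_H ip (F t.-1) (X t).
Hypothesis meps : forall t, (1 <= t)%N -> Gmeas_R (F t) (eps t).
Hypothesis ceps : forall t, (1 <= t)%N -> is_condexp P (F t.-1) (eps t) (fun _ => 0).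
Hypothesis B0 : 0 < B.
Hypothesis beps : forall t w, (1 <= t)%N -> `|eps t w| <= B.
Hypothesis veps : forall t, (1 <= t)%N -> is_condvar P (F t.-1) (eps t) (fun _ => sigma2).
Hypothesis rho0 : 0 < rho.

Let sF t : sub_sigma (F t). Proof. by case: fF. Qed.
Let mF t A : F t A -> measurable A. Proof. by case: (sF t) => _; apply. Qed.
Let leF s t : (s <= t)%N -> F s `<=` F t. Proof. by case: fF => _; apply. Qed.
Let ipl := ip_lin ip ipH.
Let ips := ip_sym ip ipH.

(* [mart], [sqs], [gain] are the paper's [M_t], [s_t^2], [|G_t|^2]; [prevM] and [cross]
   are the numbers [A] and [b] of the header. *)
Definition mart t w : H := \sum_(1 <= i < t.+1) eps i w *: X i w.
Definition covform t w (y z : H) : R := ip (resolvent ip rho (X^~ w) t y) z.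
Definition sqs t w := covform t w (mart t w) (mart t w).
Definition gain t w := covform t w (X t w) (X t w).
Definition gains t w := \sum_(1 <= i < t.+1) gain i w.
Definition prevM t w := covform t.+1 w (mart t w) (mart t w).
Definition cross t w := covform t.+1 w (mart t w) (X t.+1 w).

Lemma covform_sym t w y z : covform t w y z = covform t w z y.
Proof. by rewrite /covform resolvent_sym// ips. Qed.
Lemma covform_lin t w a x y z : covform t w (a *: x + y) z = a * covform t w x z + covform t w y z.
Proof. by rewrite /covform resolvent_lin// ipl. Qed.
Lemma covform_ge0 t w y : 0 <= covform t w y y.
Proof. exact: resolvent_pos. Qed.

Lemma martS t w : mart t.+1 w = eps t.+1 w *: X t.+1 w + mart t w.
Proof. by rewrite /mart big_nat_recr//= addrC. Qed.

Lemma sqsS t w : sqs t.+1 w =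
  prevM t w + 2 * eps t.+1 w * cross t w + eps t.+1 w ^+ 2 * gain t.+1 w.
Proof.
rewrite /sqs martS covform_lin !(covform_sym _ _ _ (_ + _)) !covform_lin.
rewrite /prevM /cross /gain (covform_sym _ _ (X t.+1 w) (mart t w)).
by ring.
Qed.

Lemma prevM_ge0 t w : 0 <= prevM t w. Proof. exact: covform_ge0. Qed.
Lemma sqs_ge0 t w : 0 <= sqs t w. Proof. exact: covform_ge0. Qed.

(** Adding a rank-one term shrinks the inverse: the Sherman-Morrison correction is a nonnegative
    square over a positive denominator. *)
Lemma prevM_le t w : prevM t w <= sqs t w.
Proof.
rewrite /prevM /sqs /covform resolventS// gerBl divr_ge0// -?expr2 ?sqr_ge0//.
by rewrite addr_ge0//; exact: resolvent_pos.
Qed.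

(** With [k] the form of the previous resolvent at [X t.+1], the updated form equals
    [k / (1 + k)]. *)
Lemma gain_bounds t w : 0 <= gain t.+1 w <= 1.
Proof.
rewrite [X in X && _]covform_ge0/= /gain /covform resolventS//.
have := resolvent_pos ip ipH rho (X^~ w) rho0 t (X t.+1 w).
set k := ip _ _ => k0; have k1 : 0 < 1 + k by rewrite ltr_wpDr.
have -> : k - k * k / (1 + k) = k / (1 + k) by field; rewrite gt_eqF.
by rewrite ler_pdivrMr// mul1r lerDr.
Qed.

Lemma cross_sqr t w : cross t w ^+ 2 <= prevM t w * gain t.+1 w.
Proof. exact: resolvent_CS. Qed.

Lemma gains_ge0 t w : 0 <= gains t w.
Proof.
rewrite /gains big_add1 /= big_mkord; apply: sumr_ge0 => i _.
by case/andP: (gain_bounds i w).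
Qed.

Lemma gainsS t w : gains t.+1 w = gains t w + gain t.+1 w.
Proof. by rewrite /gains big_nat_recr. Qed.

(** Each step raises [s_t] by at most [B]. This deterministic bound is what makes the linear term
    [D] of [coshproc_super] integrable. *)
Lemma sqrt_sqs_le t w : Num.sqrt (sqs t w) <= t%:R * B.
Proof.
have tB n : 0 <= n%:R * B by rewrite mulr_ge0// ltW.
elim: t => [|t IH].
  by rewrite /sqs /mart big_geq// /covform (form0r _ ips ipl) sqrtr0 mul0r.
rewrite -(@ler_pXn2r _ 2)// ?nnegrE ?sqrtr_ge0// sqr_sqrtr ?sqs_ge0// sqsS -natr1 mulrDl mul1r.
have A0 := prevM_ge0 t w; have /andP[g0 g1] := gain_bounds t w.
have sA : Num.sqrt (prevM t w) <= t%:R * B by rewrite (le_trans _ IH)// ler_wsqrtr// prevM_le.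
have bA : `|cross t w| <= Num.sqrt (prevM t w).
  rewrite -(@ler_pXn2r _ 2)// ?nnegrE ?sqrtr_ge0// real_normK ?num_real// sqr_sqrtr//.
  by rewrite (le_trans (cross_sqr t w))// ler_piMr.
have eB := beps t.+1 w isT.
have h1 : eps t.+1 w * cross t w <= B * (t%:R * B).
  apply: le_trans (ler_norm _) _; rewrite normrM; apply: ler_pM => //.
  exact: le_trans bA sA.
have h2 : eps t.+1 w ^+ 2 * gain t.+1 w <= B ^+ 2.
  rewrite -[X in _ <= X]mulr1; apply: ler_pM => //; first exact: sqr_ge0.
  by rewrite -real_normK ?num_real// ler_pXn2r ?nnegrE// ltW.
have h3 : prevM t w <= (t%:R * B) ^+ 2.
  by rewrite -(sqr_sqrtr A0) ler_pXn2r ?nnegrE ?sqrtr_ge0.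
by move: h1 h2 h3; lra.
Qed.

Lemma adapted_eps n i : (i < n)%N -> adapted (F n) (eps i.+1).
Proof.
move=> lein; apply: (adapted_le _ _ (F i.+1)) => //; first exact: leF.
by apply: Gmeas_adapted; [exact: sF|exact: meps].
Qed.

(** The indices reflect predictability: [X i.+1] is [F i]-measurable, so the resolvent of index
    [n.+1], built from [X 1] to [X n.+1], is already known at time [n]. The recursion reduces
    everything to scalar products of the [X i]; forms in [mart n] follow by bilinear expansion. *)
Lemma adapted_covXX n t i j : (t <= n.+1)%N -> (i <= n)%N -> (j <= n)%N ->
  adapted (F n) (fun w => covform t w (X i.+1 w) (X j.+1 w)).
Proof.
elim: t i j => [|t IH] i j tn lein jn.
  rewrite /covform /=.
  have -> : (fun w => ip (rho^-1 *: X i.+1 w) (X j.+1 w)) =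
            (fun w => rho^-1 * ip (X i.+1 w) (X j.+1 w)).
    by apply/funext => w; rewrite (formZl _ ipl).
  apply: measurable_funM => //; apply: adapted_ip => //.
    by move=> U oU; apply: (leF i) => //; exact: (mX i.+1).
  by move=> U oU; apply: (leF j) => //; exact: (mX j.+1).
have -> : (fun w => covform t.+1 w (X i.+1 w) (X j.+1 w)) =
  (fun w => covform t w (X i.+1 w) (X j.+1 w) -
     covform t w (X t.+1 w) (X i.+1 w) * covform t w (X t.+1 w) (X j.+1 w)
      * (1 + covform t w (X t.+1 w) (X t.+1 w))^-1).
  by apply/funext => w; rewrite /covform resolventS.
have tn' := ltnW tn.
apply: measurable_funB; first exact: IH.
apply: measurable_funM; first by apply: measurable_funM; exact: IH.
by apply: measurable_inv; apply: measurable_funD => //; exact: IH.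
Qed.

Lemma adapted_covMX n t j : (t <= n.+1)%N -> (j <= n)%N ->
  adapted (F n) (fun w => covform t w (mart n w) (X j.+1 w)).
Proof.
move=> tn jn.
have -> : (fun w => covform t w (mart n w) (X j.+1 w)) =
  (fun w => \sum_(i < n) eps i.+1 w * covform t w (X i.+1 w) (X j.+1 w)).
  apply/funext => w; rewrite /mart big_add1/= big_mkord.
  rewrite (form_suml (covform t w) (covform_lin t w)).
  by apply: eq_bigr => i _; rewrite (formZl _ (covform_lin t w)).
apply: measurable_sum => i; apply: measurable_funM; first exact: adapted_eps.
by apply: adapted_covXX => //; exact: ltnW.
Qed.

Lemma adapted_covMM n t : (t <= n.+1)%N ->
  adapted (F n) (fun w => covform t w (mart n w) (mart n w)).
Proof.
move=> tn.
have -> : (fun w => covform t w (mart n w) (mart n w)) =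
  (fun w => \sum_(i < n) eps i.+1 w * covform t w (mart n w) (X i.+1 w)).
  apply/funext => w; rewrite {2}/mart big_add1/= big_mkord.
  rewrite (form_sumr (covform t w) (covform_sym t w) (covform_lin t w)).
  by apply: eq_bigr => i _; rewrite (formZr _ (covform_sym t w) (covform_lin t w)).
apply: measurable_sum => i; apply: measurable_funM; first exact: adapted_eps.
by apply: adapted_covMX => //; exact: ltnW.
Qed.

Lemma adapted_sqs n : adapted (F n) (sqs n).
Proof. by apply: adapted_covMM. Qed.
Lemma adapted_prevM n : adapted (F n) (prevM n).
Proof. by apply: adapted_covMM. Qed.
Lemma adapted_cross n : adapted (F n) (cross n).
Proof. by apply: adapted_covMX. Qed.
Lemma adapted_gain n i : (i <= n)%N -> adapted (F n) (gain i.+1).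
Proof. by move=> lein; apply: adapted_covXX. Qed.
Lemma adapted_gains n t : (t <= n.+1)%N -> adapted (F n) (gains t).
Proof.
move=> tn; have -> : gains t = (fun w => \sum_(i < t) gain i.+1 w).
  by apply/funext => w; rewrite /gains big_add1 /= big_mkord.
apply: measurable_sum => i; apply: adapted_gain.
by rewrite -ltnS; apply: leq_trans tn.
Qed.

Let meps' t : measurable_fun setT (eps t.+1).
Proof. exact: adapted_measurable (sF t.+1) (adapted_eps _ _ (ltnSn t)). Qed.

Local Open Scope ereal_scope.

Lemma integral_eps_sqr t A : F t A ->
  \int[P]_(w in A) (eps t.+1 w ^+ 2)%:E = sigma2%:E * P A.
Proof.
move=> FA; rewrite (condvar_sqr _ _ _ _ _ _ (fun=> sigma2) _ (sF t) (ceps t.+1 isT) (veps t.+1 isT))//.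
by rewrite integral_cst//; exact: mF FA.
Qed.

Lemma sigma2_ge0 : (0 <= sigma2)%R.
Proof.
have FT : F 0 setT by rewrite -sub_sigmaE.
have := integral_eps_sqr 0 setT FT; rewrite probability_setT mule1 => h.
by rewrite -lee_fin -h; apply: integral_ge0 => w _; rewrite lee_fin sqr_ge0.
Qed.

(** Meant for [c = 1] and [c = -1]: the shift by [B] makes the function nonnegative, as
    [integral_cond_const] requires, and its conditional mean is the constant [B]. *)
Lemma integral_eps_affine t A (c : R) : F t A ->
  \int[P]_(w in A) (c * eps t.+1 w + B)%:E = B%:E * P A.
Proof.
move=> FA; have mA := mF _ _ FA; have [ie _ _ e0] := ceps t.+1 isT.
have ie' : P.-integrable A (EFin \o eps t.+1) by apply: integrableS ie.
under eq_integral do rewrite EFinD EFinM.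
rewrite integralD//; last 2 first.
- exact: integrableZl.
- exact: finite_measure_integrable_cst.
by rewrite integralZl// e0// integral0 mule0 add0e integral_cst.
Qed.

Definition psiB (lam : R) : R := ((expR (lam * B) - 1 - lam * B) / B ^+ 2)%R.

Lemma psiB_ge0 lam : (0 <= psiB lam)%R.
Proof.
rewrite /psiB divr_ge0 ?sqr_ge0//; have := expR_ge1Dx (lam * B); lra.
Qed.

Definition coshproc (lam : R) t w : R :=
  (cosh (lam * Num.sqrt (sqs t w)) * expR (- (psiB lam * sigma2 * gains t w)))%R.

Lemma coshproc_ge0 lam t w : (0 <= coshproc lam t w)%R.
Proof. by rewrite mulr_ge0 ?expR_ge0// ltW// cosh_gt0. Qed.

Lemma measurable_coshproc (lam : R) t : measurable_fun setT (coshproc lam t).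
Proof.
apply: (adapted_measurable _ _ (F t)) => //.
apply: measurable_funM.
  by apply/measurable_cosh/measurable_funM => //; apply: measurable_sqrt; exact: adapted_sqs.
apply/measurable_expR_comp/measurable_funN/measurable_funM => //.
exact: adapted_gains.
Qed.

(** [cosh_one_step] is multiplied by the predictable weight [E] and integrated: [eps^2] becomes
    [sigma2], the linear term averages out, and [(1 + y) exp (- y) <= 1] absorbs the variance
    increment into the compensator. *)
Lemma coshproc_super (lam : R) t A : (0 <= lam)%R -> F t A ->
  \int[P]_w (\1_A w * coshproc lam t.+1 w)%:E <= \int[P]_w (\1_A w * coshproc lam t w)%:E.
Proof.
move=> l0 FA.
pose sA w := Num.sqrt (prevM t w).
(* The compensator of time [t.+1] involves [X] only up to [t.+1], so it is [F t]-measurable. *)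
pose E w := (\1_A w * expR (- (psiB lam * sigma2 * gains t.+1 w)))%R.
pose D w := (lam * cross t w * sinh (lam * sA w) / sA w)%R.
pose U w := (E w * cosh (lam * sA w))%R.
pose W3 w := (U w * (psiB lam * gain t.+1 w))%R.
pose Dp w := (E w * Num.max (D w) 0)%R.
pose Dn w := (E w * Num.max (- D w) 0)%R.
have sg := sigma2_ge0.
have asA : adapted (F t) sA by apply: measurable_sqrt; exact: adapted_prevM.
have aE : adapted (F t) E.
  apply: measurable_funM; first by apply: measurable_indic; rewrite sub_sigmaE.
  apply/measurable_expR_comp/measurable_funN/measurable_funM => //.
  exact: adapted_gains.
have aD : adapted (F t) D.
  apply: measurable_funM; last exact: measurable_inv.
  apply: measurable_funM; last by apply/measurable_sinh/measurable_funM.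
  by apply: measurable_funM => //; exact: adapted_cross.
have aU : adapted (F t) U by apply: measurable_funM => //; apply/measurable_cosh/measurable_funM.
have aW3 : adapted (F t) W3.
  by apply: measurable_funM => //; apply: measurable_funM => //; exact: adapted_gain.
have aDp : adapted (F t) Dp.
  by apply: measurable_funM => //; apply: measurable_maxr.
have aDn : adapted (F t) Dn.
  by apply: measurable_funM => //; apply: measurable_maxr => //; exact: measurable_funN.
have E0 w : (0 <= E w <= 1)%R.
  rewrite /E mulr_ge0 ?expR_ge0//= mulr_ile1 ?expR_ge0//.
  rewrite expR_le1 oppr_le0; apply: mulr_ge0; last exact: gains_ge0.
  by apply: mulr_ge0 => //; exact: psiB_ge0.
have E0' w : (0 <= E w)%R by case/andP: (E0 w).
have U0 w : (0 <= U w)%R by rewrite mulr_ge0// ltW// cosh_gt0.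
have gb w := gain_bounds t w.
have W30 w : (0 <= W3 w)%R.
  by apply: mulr_ge0 => //; apply: mulr_ge0; [exact: psiB_ge0|case/andP: (gb w)].
have Dp0 w : (0 <= Dp w)%R by rewrite mulr_ge0// le_max lexx orbT.
have Dn0 w : (0 <= Dn w)%R by rewrite mulr_ge0// le_max lexx orbT.
(* Here [|cross| <= sqrt (prevM)] cancels the division by [sA], the zero case being covered by
   [0^-1 = 0], and [sqrt_sqs_le] bounds the hyperbolic factor. *)
have Dbd w : (`|D w| <= lam * cosh (lam * (t%:R * B)))%R.
  have sA0 : (0 <= sA w)%R := sqrtr_ge0 _.
  rewrite /D; have [->|nz] := eqVneq (sA w) 0%R.
    by rewrite invr0 mulr0 normr0 mulr_ge0// ltW// cosh_gt0.
  have sAp : (0 < sA w)%R by rewrite lt0r nz.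
  rewrite -mulrA normrM [`|lam * _|%R]normrM (ger0_norm l0) -mulrA ler_wpM2l//.
  rewrite normrM normfV (ger0_norm sA0) mulrCA mulrC -mulrA.
  have h1 : (`|cross t w| / sA w <= 1)%R.
    rewrite ler_pdivrMr// mul1r -(@ler_pXn2r _ 2)// ?nnegrE// real_normK ?num_real//.
    rewrite sqr_sqrtr ?prevM_ge0// (le_trans (cross_sqr t w))// ler_piMr ?prevM_ge0//.
    by case/andP: (gb w).
  have h2 : (`|sinh (lam * sA w)| <= cosh (lam * (t%:R * B)))%R.
    rewrite ger0_norm ?sinh_ge0 ?mulr_ge0//; apply: le_trans (sinh_le_cosh _) _.
    apply: le_cosh; rewrite ?mulr_ge0// ler_wpM2l// (le_trans _ (sqrt_sqs_le t w))//.
    by rewrite ler_wsqrtr// prevM_le.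
  rewrite [X in (X <= _)%R](_ : _ = `|sinh (lam * sA w)| * (`|cross t w| / sA w))%R; last by ring.
  by rewrite -[X in (_ <= X)%R]mulr1; apply: ler_pM => //; rewrite divr_ge0.
have bfin (f : Omega -> R) (aDf : adapted (F t) f) : (forall w, 0 <= f w)%R ->
    (forall w, f w <= lam * cosh (lam * (t%:R * B)))%R -> \int[P]_w (f w)%:E \is a fin_num.
  move=> f0 fb; rewrite ge0_fin_numE; last by apply: integral_ge0 => w _; rewrite lee_fin.
  apply: (@le_lt_trans _ _ (\int[P]_w (lam * cosh (lam * (t%:R * B)))%:E)).
    apply: ge0_le_integral => //.
    - by move=> w _; rewrite lee_fin.
    - by apply/measurable_EFinP; exact: adapted_measurable aDf.
    - by move=> w _; rewrite lee_fin.
  by rewrite integral_cst//= (@probability_setT _ _ _ P) mule1 ltry.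
have finDp : \int[P]_w (Dp w)%:E \is a fin_num.
  apply: bfin => // w; rewrite /Dp -[X in (_ <= X)%R]mul1r; apply: ler_pM => //.
  - by rewrite le_max lexx orbT.
  - by case/andP: (E0 w).
  - by rewrite ge_max (le_trans (ler_norm _) (Dbd w))/= mulr_ge0// ltW// cosh_gt0.
have finDn : \int[P]_w (Dn w)%:E \is a fin_num.
  apply: bfin => // w; rewrite /Dn -[X in (_ <= X)%R]mul1r; apply: ler_pM => //.
  - by rewrite le_max lexx orbT.
  - by case/andP: (E0 w).
  - rewrite ge_max (le_trans (ler_norm _))/= ?normrN ?Dbd//.
    by rewrite mulr_ge0// ltW// cosh_gt0.
have mm (f : Omega -> R) : adapted (F t) f -> measurable_fun setT f.
  by move=> af; exact: adapted_measurable af.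
have m1A : measurable_fun setT (\1_A : Omega -> R).
  by apply: measurable_indic; exact: mF FA.
have mS n : measurable_fun setT (fun w => \1_A w * coshproc lam n w)%R.
  by apply: measurable_funM => //; exact: measurable_coshproc.
(* [B * Dp + B * Dn] is added to both sides, which turns [E * D * eps] into the nonnegative
   [Dp * (eps + B) + Dn * (- eps + B)]. *)
have ptw w : (\1_A w * coshproc lam t.+1 w + (B * Dp w + B * Dn w) <=
    U w + (W3 w * eps t.+1 w ^+ 2 + (Dp w * (1 * eps t.+1 w + B) + Dn w * (- 1 * eps t.+1 w + B))))%R.
  have h := @cosh_one_step R (prevM t w) (cross t w) (gain t.+1 w) (eps t.+1 w) B lam
    (prevM_ge0 t w) (gb w) (cross_sqr t w) B0 (beps t.+1 w isT) l0.
  have DE : D w = (Num.max (D w) 0 - Num.max (- D w) 0)%R.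
    have [d0|/ltW d0] := leP 0%R (D w).
      by rewrite max_r ?oppr_le0// subr0.
    by rewrite max_l ?oppr_ge0// sub0r opprK.
  have -> : (\1_A w * coshproc lam t.+1 w = E w * cosh (lam * Num.sqrt (sqs t.+1 w)))%R.
    by rewrite /E /coshproc; ring.
  rewrite sqsS; have := ler_wpM2l (E0' w) h.
  rewrite -/(psiB lam) -/(sA w) -/(D w) {1}DE /U /W3 /Dp /Dn /U.
  move: (E w) (cosh (lam * sA w)) (Num.max (D w) 0)%R (Num.max (- D w) 0)%R (psiB lam)
    (gain t.+1 w) (eps t.+1 w) (cosh (lam * Num.sqrt (prevM t w + _ + _)))%R.
  move=> a1 a2 a3 a4 a5 a6 a7 a8; lra.
have int_le : \int[P]_w (\1_A w * coshproc lam t.+1 w)%:E +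
    (B%:E * \int[P]_w (Dp w)%:E + B%:E * \int[P]_w (Dn w)%:E) <=
   \int[P]_w (U w)%:E + (sigma2%:E * \int[P]_w (W3 w)%:E +
    (B%:E * \int[P]_w (Dp w)%:E + B%:E * \int[P]_w (Dn w)%:E)).
  have eB0 c w : (`|c| <= 1 -> 0 <= c * eps t.+1 w + B)%R.
    move=> c1; have := beps t.+1 w isT => be.
    have : (`|c * eps t.+1 w| <= B)%R.
      by rewrite normrM -[X in (_ <= X)%R]mul1r; apply: ler_pM.
    by rewrite ler_norml; lra.
  have n1 : (`|1| <= 1 :> R)%R by rewrite normr1.
  have n1' : (`|- 1| <= 1 :> R)%R by rewrite normrN1.
  have meB c : measurable_fun setT (fun w => c * eps t.+1 w + B)%R.
    by apply: measurable_funD => //; exact: measurable_funM.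
  rewrite -(integral_cond_const P (F t) W3 (fun w => eps t.+1 w ^+ 2)%R) //; last 3 first.
  - exact: measurable_funX.
  - by move=> w; exact: sqr_ge0.
  - by move=> ? ?; exact: integral_eps_sqr.
  rewrite -{2}(integral_cond_const P (F t) Dp (fun w => 1 * eps t.+1 w + B)%R) //; last 3 first.
  - by move=> w; exact: eB0.
  - exact: ltW.
  - by move=> ? ?; exact: integral_eps_affine.
  rewrite -{2}(integral_cond_const P (F t) Dn (fun w => -1 * eps t.+1 w + B)%R) //; last 3 first.
  - by move=> w; exact: eB0.
  - exact: ltW.
  - by move=> ? ?; exact: integral_eps_affine.
  rewrite -!ge0_integralZl//; last 6 first.
  - exact/measurable_EFinP/mm.
  - by move=> w _; rewrite lee_fin.
  - by rewrite lee_fin ltW.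
  - exact/measurable_EFinP/mm.
  - by move=> w _; rewrite lee_fin.
  - by rewrite lee_fin ltW.
  have addI (f g : Omega -> R) : measurable_fun setT f -> measurable_fun setT g ->
     (forall w, 0 <= f w)%R -> (forall w, 0 <= g w)%R ->
     \int[P]_w (f w)%:E + \int[P]_w (g w)%:E = \int[P]_w (f w + g w)%:E.
    move=> mf mg f0 g0; rewrite -ge0_integralD//.
    - by move=> w _; rewrite lee_fin.
    - exact/measurable_EFinP.
    - by move=> w _; rewrite lee_fin.
    - exact/measurable_EFinP.
  have mB (f : Omega -> R) : adapted (F t) f -> measurable_fun setT (fun w => B * f w)%R.
    by move=> af; apply: measurable_funM => //; exact: mm.
  have mp (f : Omega -> R) (c : R) : adapted (F t) f -> measurable_fun setT (fun w => f w * (c * eps t.+1 w + B))%R.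
    by move=> af; apply: measurable_funM => //; exact: mm.
  have mW3 : measurable_fun setT (fun w => W3 w * eps t.+1 w ^+ 2)%R.
    by apply: measurable_funM; [exact: mm|exact: measurable_funX].
  have p1 w : (0 <= \1_A w * coshproc lam t.+1 w)%R.
    by rewrite mulr_ge0 ?coshproc_ge0.
  have p2 w : (0 <= B * Dp w)%R by rewrite mulr_ge0// ltW.
  have p3 w : (0 <= B * Dn w)%R by rewrite mulr_ge0// ltW.
  have p4 w : (0 <= Dp w * (1 * eps t.+1 w + B))%R by rewrite mulr_ge0// eB0.
  have p5 w : (0 <= Dn w * (-1 * eps t.+1 w + B))%R by rewrite mulr_ge0// eB0.
  have p6 w : (0 <= W3 w * eps t.+1 w ^+ 2)%R by rewrite mulr_ge0// sqr_ge0.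
  under [X in _ + (X + _) <= _]eq_integral do rewrite -EFinM.
  under [X in _ + (_ + X) <= _]eq_integral do rewrite -EFinM.
  rewrite (addI (fun w => B * Dp w)%R (fun w => B * Dn w)%R)//; [|exact: mB|exact: mB].
  rewrite (addI (fun w => \1_A w * coshproc lam t.+1 w)%R (fun w => B * Dp w + B * Dn w)%R)//; [|by apply: measurable_funD; exact: mB|by move=> w; rewrite addr_ge0].
  rewrite (addI (fun w => Dp w * _)%R (fun w => Dn w * _)%R)//; [|exact: mp|exact: mp].
  rewrite (addI (fun w => W3 w * _)%R)//; [|by apply: measurable_funD; exact: mp|by move=> w; rewrite addr_ge0].
  rewrite addI//; [|exact: mm|by apply: measurable_funD => //; apply: measurable_funD; exact: mp|by move=> w; rewrite !addr_ge0].
  apply: ge0_le_integral => //.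
  - by move=> w _; rewrite lee_fin !addr_ge0.
  - by apply/measurable_EFinP; apply: measurable_funD => //; apply: measurable_funD; exact: mB.
  - apply/measurable_EFinP; apply: measurable_funD; first exact: mm.
    by apply: measurable_funD => //; apply: measurable_funD; exact: mp.
  - by move=> w _; rewrite lee_fin; exact: ptw.
(* Finiteness is what allows the added terms to be cancelled in the extended reals. *)
have finD : B%:E * \int[P]_w (Dp w)%:E + B%:E * \int[P]_w (Dn w)%:E \is a fin_num.
  by rewrite fin_numD !fin_numM.
move: int_le; rewrite [X in _ <= X]addeA leeD2rE// => int_le; apply: le_trans int_le _.
rewrite -ge0_integralZl//; last 2 first.
- exact/measurable_EFinP/mm.
- by move=> w _; rewrite lee_fin.
rewrite -ge0_integralD//; last 4 first.
- by move=> w _; rewrite lee_fin.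
- exact/measurable_EFinP/mm.
- by move=> w _; rewrite mule_ge0// lee_fin.
- by apply: measurable_funeM; exact/measurable_EFinP/mm.
apply: ge0_le_integral => //.
- by move=> w _; rewrite adde_ge0 ?mule_ge0// lee_fin.
- apply: emeasurable_funD; first exact/measurable_EFinP/mm.
  by apply: measurable_funeM; exact/measurable_EFinP/mm.
- exact/measurable_EFinP.
move=> w _; rewrite -EFinM -EFinD lee_fin /W3 /U /E /coshproc gainsS.
have i0 : (0 <= \1_A w :> R)%R by [].
rewrite mulrDr opprD expRD.
set y := (psiB lam * sigma2 * gain t.+1 w)%R.
have hc : (cosh (lam * sA w) <= cosh (lam * Num.sqrt (sqs t w)))%R.
  by apply: le_cosh; rewrite ?mulr_ge0 ?sqrtr_ge0// ler_wpM2l// ler_wsqrtr// prevM_le.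
set e1 := expR (- (psiB lam * sigma2 * gains t w))%R.
have hy : (expR (- y) * (1 + y) <= 1)%R.
  by rewrite expRN mulrC ler_pdivrMr ?expR_gt0// mul1r expR_ge1Dx.
rewrite [X in (X <= _)%R](_ : _ = \1_A w * (e1 * (cosh (lam * sA w) * (expR (- y) * (1 + y)))))%R; last first.
  by rewrite /y; ring.
rewrite ler_wpM2l//.
rewrite [X in (_ <= X)%R]mulrC ler_wpM2l ?expR_ge0//.
by apply: le_trans hc; rewrite -[X in (_ <= X)%R]mulr1 ler_wpM2l// ltW// cosh_gt0.
Qed.

Notation mu := (@lebesgue_measure R).
Variable p : R -> R.
Hypothesis p0 : forall v, (0 <= p v)%R.
Hypothesis mp : measurable_fun setT p.
Hypothesis p1 : \int[mu]_(v in `[1%R, +oo[) (p v)%:E <= 1.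

(** Parametrised from the outset by [v = exp (B lam)], so [lam >= 0] reads [v >= 1] and no change of
    variable in [lam] has to be carried out. The value may be infinite. *)
Definition mixture t w : \bar R :=
  \int[mu]_(v in `[1%R, +oo[) (coshproc (ln v / B) t w * p v)%:E.

Lemma mixture_ge0 t w : 0 <= mixture t w.
Proof. by apply: integral_ge0 => v _; rewrite lee_fin mulr_ge0 ?coshproc_ge0. Qed.

(** The conditional extends the integrand to the whole line for Tonelli. The factor [h] is 1 for
    adaptedness, over [F t], and the indicator of [A] for the supermartingale property, over the
    ambient sigma-algebra. *)
Lemma measurable_mixture_kernel d' (T : measurableType d') (h q g : T -> R) :
  measurable_fun setT h -> measurable_fun setT q -> measurable_fun setT g ->
  measurable_fun setT (fun z : T * R => (if (1 <= z.2)%R then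
    h z.1 * (cosh (ln z.2 / B * Num.sqrt (q z.1)) *
      expR (- (psiB (ln z.2 / B) * sigma2 * g z.1)) * p z.2) else 0)%:E).
Proof.
move=> mh mq mg; apply/measurable_EFinP; apply: measurable_fun_ifT => //.
  by apply: measurable_fun_ler => //; exact: measurable_snd.
have m1 (f : T -> R) : measurable_fun setT f -> measurable_fun setT (fun z : T * R => f z.1).
  by move=> mf; exact: measurableT_comp measurable_fst.
have m2 (f : R -> R) : measurable_fun setT f -> measurable_fun setT (fun z : T * R => f z.2).
  by move=> mf; exact: measurableT_comp measurable_snd.
have mlam : measurable_fun setT (fun v : R => ln v / B)%R.
  by apply: measurable_funM => //; exact: measurable_ln.
have mpsi : measurable_fun setT (fun v : R => psiB (ln v / B)).
  apply: measurable_funM => //; apply: measurable_funB; last exact: measurable_funM.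
  apply: measurable_funB => //; apply: measurable_expR_comp; exact: measurable_funM.
apply: measurable_funM; first exact: m1.
apply: measurable_funM; last exact: m2.
apply: measurable_funM.
  apply: measurable_cosh; apply: measurable_funM; first exact: (m2 (fun v => ln v / B)%R).
  by apply: measurable_sqrt; exact: m1.
apply: measurable_expR_comp; apply: measurable_funN; apply: measurable_funM; last exact: m1.
by apply: measurable_funM => //; exact: (m2 (fun v => psiB (ln v / B))).
Qed.

Lemma adapted_mixture t : adapted (F t) (mixture t).
Proof.
have := measurable_mixture_kernel _ (g_sigma_algebraType (F t)) (fun=> 1%R) (sqs t) (gains t)
  (measurable_cst _) (adapted_sqs t) (adapted_gains t t (leqnSn _)).
set k := (fun z => _) => mk.
have k0 z : 0 <= k z.
  by rewrite /k lee_fin; case: ifP => // _; rewrite !mulr_ge0 ?expR_ge0// ltW// cosh_gt0.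
have := @measurable_fun_fubini_tonelli_F _ _ _ _ _ mu k mk k0.
apply: eq_measurable_fun => w _; rewrite /fubini_F /mixture [RHS]integral_mkcond.
apply: eq_integral => v _; rewrite /k/= patchE mem_setE in_itv/= andbT.
by case: ifP => // _; rewrite mul1r.
Qed.

Lemma mixture_super t A : F t A ->
  \int[P]_(w in A) mixture t.+1 w <= \int[P]_(w in A) mixture t w.
Proof.
move=> FA; have mA := mF _ _ FA.
have m1A : measurable_fun setT (\1_A : Omega -> R) by exact: measurable_indic.
have mq n : measurable_fun setT (sqs n) := adapted_measurable _ _ _ _ (sF n) (adapted_sqs n).
have mg n : measurable_fun setT (gains n) :=
  adapted_measurable _ _ _ _ (sF n) (adapted_gains n n (leqnSn _)).
pose k n (z : Omega * R) : \bar R := (if (1 <= z.2)%R then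
    \1_A z.1 * (coshproc (ln z.2 / B) n z.1 * p z.2) else 0)%:E.
have mk n : measurable_fun setT (k n).
  exact: (measurable_mixture_kernel _ _ _ _ _ m1A (mq n) (mg n)).
have k0 n z : 0 <= k n z.
  by rewrite /k lee_fin; case: ifP => // _; rewrite !mulr_ge0 ?coshproc_ge0.
have swap n : \int[P]_(w in A) mixture n w = \int[mu]_v \int[P]_w k n (w, v).
  rewrite -(@fubini_tonelli _ _ _ _ _ P mu (k n) (mk n) (k0 n)) [LHS]integral_mkcond.
  apply: eq_integral => w _; rewrite patchE /k/= indicE.
  case: ifPn => wA; last first.
    by rewrite integral0_eq// => v _; case: ifP => // _; rewrite mul0r.
  rewrite /mixture integral_mkcond; apply: eq_integral => v _.
  by rewrite patchE mem_setE in_itv/= andbT; case: ifP => // _; rewrite mul1r.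
rewrite (swap t.+1) (swap t); apply: ge0_le_integral; first exact: measurableT.
- by move=> v _; apply: integral_ge0.
- exact: (@measurable_fun_fubini_tonelli_G _ _ _ _ _ P (k t.+1) (mk _) (k0 _)).
- exact: (@measurable_fun_fubini_tonelli_G _ _ _ _ _ P (k t) (mk _) (k0 _)).
move=> v _; rewrite /k/=; case: (boolP (1 <= v)%R) => v1; last by [].
have l0 : (0 <= ln v / B)%R by rewrite divr_ge0 ?ln_ge0// ltW.
have E n : \int[P]_w (\1_A w * (coshproc (ln v / B) n w * p v))%:E =
    \int[P]_w (\1_A w * coshproc (ln v / B) n w)%:E * (p v)%:E.
  rewrite -ge0_integralZr ?lee_fin//; last 2 first.
  - by apply/measurable_EFinP; apply: measurable_funM => //; exact: measurable_coshproc.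
  - by move=> w _; rewrite lee_fin mulr_ge0 ?coshproc_ge0.
  by apply: eq_integral => w _; rewrite -EFinM mulrA.
by rewrite !E lee_wpmul2r ?lee_fin//; exact: coshproc_super.
Qed.

Lemma mixture_init : \int[P]_w mixture 0 w <= 1.
Proof.
have E w : mixture 0 w = \int[mu]_(v in `[1%R, +oo[) (p v)%:E.
  apply: eq_integral => v _; rewrite /coshproc /sqs /gains /mart !big_geq//.
  by rewrite /covform (form0r _ ips ipl) sqrtr0 !mulr0 cosh0 oppr0 expR0 !mul1r.
rewrite (@eq_integral _ _ _ P setT (fun=> \int[mu]_(v in `[1%R, +oo[) (p v)%:E)) => [|w _]; last exact: E.
by rewrite integral_cst//= (@probability_setT _ _ _ P) mule1.
Qed.

Lemma mixture_ville (delta : R) : (0 < delta)%R ->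
  P [set w | (delta^-1)%:E <= ereal_sup (range (mixture^~ w))] <= delta%:E.
Proof.
exact (ville_sup P F fF mixture mixture_ge0 adapted_mixture mixture_super mixture_init delta).
Qed.

End Process.

(** * Incomplete gamma integrals *)

Section Gamma.
Context {R : realType}.
Notation mu := (@lebesgue_measure R).

Section Scale.
Variables (x : R) (x0 : 0 < x).
Let phi (v : measurableTypeR R) : measurableTypeR R := x * v.
Let mphi : measurable_fun setT phi. Proof. exact: measurable_funM. Qed.
Let pm : {measure set (measurableTypeR R) -> \bar R} :=
  measure_function_pushforward__canonical__measure_function_Measure mu mphi.
Let k := NngNum (ltW x0).

(** [x] times the image of Lebesgue measure under [v |-> x v] gives each interval []a, b]] its
    length, and these values determine Lebesgue measure. *)
Lemma lebesgue_measure_scale (A : set (measurableTypeR R)) : measurable A ->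
  mu A = mscale k pm A.
Proof.
apply: lebesgue_measure_unique => // _ [[a b]] _ <-.
transitivity (x%:E * mu (phi @^-1` `]a, b]%classic))%E => //.
have -> : phi @^-1` `]a, b] = `]x^-1 * a, x^-1 * b]%classic.
  by apply/seteqP; split => v /=; rewrite !in_itv/= ltr_pdivrMl// ler_pdivlMl.
rewrite !lebesgue_measure_itv/= !lte_fin ltr_pM2l ?invr_gt0//.
case: ltP => _; last by rewrite mule0.
by rewrite -!EFinD -EFinM -mulrN -mulrDr mulVKf ?gt_eqF.
Qed.

Lemma ge0_integral_scale (f : R -> \bar R) :
  measurable_fun setT f -> (forall r, 0 <= f r)%E ->
  (\int[mu]_(u in `[x, +oo[) f u = x%:E * \int[mu]_(v in `[1%R, +oo[) f (x * v)%R)%E.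
Proof.
move=> mf f0.
rewrite (@eq_measure_integral _ (measurableTypeR R) R `[x, +oo[%classic (mscale k pm)); last first.
  by move=> A mA _; exact: lebesgue_measure_scale.
rewrite ge0_integral_mscale//; last exact: measurable_funTS.
congr (_ * _)%E.
rewrite (ge0_integral_pushforward mphi)//; last exact: measurable_funTS.
congr integral; apply/seteqP; split => v /=; rewrite !in_itv/= !andbT.
  by rewrite ler_pMr.
by rewrite ler_pMr.
Qed.
End Scale.

Lemma measurable_powR2 d (T : measurableType d) (f g : T -> R) :
  measurable_fun setT f -> measurable_fun setT g ->
  measurable_fun setT (fun z => powR (f z) (g z)).
Proof.
move=> mf mg; rewrite /powR.
apply: measurable_fun_ifT.
- apply: measurable_fun_eqr => //.
- have -> : (fun z => (g z == 0)%:R : R) = (fun z => if g z == 0 then 1 else 0).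
    by apply/funext => z; case: ifP.
  by apply: measurable_fun_ifT => //; apply: measurable_fun_eqr.
- apply: measurableT_comp => //; apply: measurable_funM => //.
  exact: measurableT_comp.
Qed.

(** Kept in the extended reals: [fine] sends an infinite integral to 0, so [GammaF] and [gbar] are
    compared with it by inequality. *)
Definition upper_gamma (a x : R) : \bar R :=
  (\int[mu]_(u in [set u : R | (x <= u)%R]) (powR u (a - 1) * expR (- u))%R%:E)%E.

Lemma upper_gamma_ge0 a x : (0 <= upper_gamma a x)%E.
Proof. by apply: integral_ge0 => u _; rewrite lee_fin mulr_ge0 ?powR_ge0 ?expR_ge0. Qed.

Lemma measurable_gamma_density d (T : measurableType d) (f g : T -> R) :
  measurable_fun setT f -> measurable_fun setT g ->
  measurable_fun setT (fun z => powR (f z) (g z - 1) * expR (- f z)).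
Proof.
move=> mf mg; apply: measurable_funM.
  by apply: measurable_powR2 => //; apply: measurable_funB.
by apply: measurableT_comp => //; exact: measurable_funN.
Qed.

Lemma measurable_upper_gamma d (T : measurableType d) (f g : T -> R) :
  measurable_fun setT f -> measurable_fun setT g ->
  measurable_fun setT (fun z => upper_gamma (f z) (g z)).
Proof.
move=> mf mg.
pose h (z : T * R) : \bar R :=
  (if (g z.1 <= z.2)%R then (powR z.2 (f z.1 - 1) * expR (- z.2))%R else 0%R)%:E.
have mh : measurable_fun setT h.
  apply/measurable_EFinP; apply: measurable_fun_ifT => //.
  - apply: measurable_fun_ler; last exact: measurable_snd.
    exact: measurableT_comp measurable_fst.
  - apply: measurable_gamma_density; first exact: measurable_snd.
    exact: measurableT_comp measurable_fst.
have h0 z : (0 <= h z)%E.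
  by rewrite /h lee_fin; case: ifP => // _; rewrite mulr_ge0 ?powR_ge0 ?expR_ge0.
have := @measurable_fun_fubini_tonelli_F _ _ _ _ _ mu h mh h0.
apply: eq_measurable_fun => z _; rewrite /fubini_F /upper_gamma [RHS]integral_mkcond.
apply: eq_integral => u _; rewrite /h/= patchE; case: ifPn => hz; first by rewrite mem_set.
by rewrite memNset//=; apply/negP.
Qed.

Lemma GammaFE (a : R) : GammaF a = fine (upper_gamma a 0).
Proof. by []. Qed.
Lemma gbarE (a x : R) : gbar a x = (GammaF a)^-1 * fine (upper_gamma a x).
Proof. by []. Qed.

Lemma measurable_GammaF d (T : measurableType d) (f : T -> R) :
  measurable_fun setT f -> measurable_fun setT (fun z => GammaF (f z)).
Proof.
move=> mf; apply: (measurableT_comp (fine_measurable _)) => //.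
exact: measurable_upper_gamma.
Qed.

Lemma GammaF_gbar_ge0 (a x : R) : 0 <= GammaF a * gbar a x.
Proof.
have G0 : 0 <= GammaF a by rewrite GammaFE fine_ge0// upper_gamma_ge0.
by rewrite gbarE !mulr_ge0 ?invr_ge0// fine_ge0// upper_gamma_ge0.
Qed.

(** The two factors [GammaF a] cancel, leaving [fine (upper_gamma a x)]. In the degenerate cases,
    [GammaF a = 0] or an infinite integral, the left side is 0. *)
Lemma GammaF_gbar_le (a x : R) : ((GammaF a * gbar a x)%:E <= upper_gamma a x)%E.
Proof.
have u0 := upper_gamma_ge0 a x.
have [G0|G0] := eqVneq (GammaF a) 0; first by rewrite G0 mul0r.
rewrite gbarE mulVKf//; case: (upper_gamma a x) u0 => [r| |]//=.
Qed.

(** The substitution [u = x v], which moves the lower limit to 1 and so matches the range of the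
    mixing variable. *)
Lemma upper_gammaE (a x : R) : 0 < x -> (upper_gamma a x =
  (powR x a)%:E * \int[mu]_(v in `[1%R, +oo[) (powR v (a - 1) * expR (- (x * v)))%R%:E)%E.
Proof.
move=> x0; rewrite /upper_gamma.
have -> : [set u : R | x <= u] = `[x, +oo[%classic.
  by apply/seteqP; split => u /=; rewrite in_itv/= andbT.
rewrite ge0_integral_scale//; last 2 first.
- by apply/measurable_EFinP; apply: measurable_gamma_density.
- by move=> r; rewrite lee_fin mulr_ge0 ?powR_ge0 ?expR_ge0.
have xa : powR x a = x * powR x (a - 1).
  by rewrite -[in LHS](subrKC 1 a) [LHS]powRD ?(gt_eqF x0) ?implybT// powRr1// ltW.
rewrite xa EFinM -muleA; congr (_ * _)%E.
rewrite -ge0_integralZl//; last 3 first.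
- apply/measurable_funTS/measurable_EFinP; apply: measurable_funM.
    exact: measurable_powR.
  apply: measurableT_comp => //; apply: measurable_funN; exact: measurable_funM.
- by move=> v _; rewrite lee_fin mulr_ge0 ?powR_ge0 ?expR_ge0.
- by rewrite lee_fin powR_ge0.
apply: eq_integral => v; rewrite inE/= in_itv/= andbT => v1.
by rewrite -EFinM mulrA powRM// ?(ltW x0)// (le_trans ler01).
Qed.

Definition gamma_const (a : R) : R := powR a a / (GammaF a * gbar a a).

Lemma gamma_const_ge0 a : 0 <= gamma_const a.
Proof. by rewrite divr_ge0 ?powR_ge0 ?GammaF_gbar_ge0. Qed.

(* When the incomplete gamma integral is infinite or zero the constant is [0]. *)
Lemma gamma_const_normalizes a : 0 < a ->
  ((gamma_const a)%:E *
    \int[mu]_(v in `[1%R, +oo[) (powR v (a - 1) * expR (- (a * v)))%R%:E <= 1)%E.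
Proof.
move=> a0; have pa : powR a a != 0 by rewrite gt_eqF// powR_gt0.
have := upper_gammaE a a a0; set K := integral _ _ _ => uE.
have K0 : (0 <= K)%E by apply: integral_ge0 => v _; rewrite lee_fin mulr_ge0 ?powR_ge0 ?expR_ge0.
have [G0|G0] := eqVneq (GammaF a) 0.
  by rewrite /gamma_const G0 mul0r invr0 mulr0 mul0e.
rewrite /gamma_const gbarE mulVKf// uE.
case: K K0 {uE} => [r| |]// r0.
  rewrite -EFinM /=.
  have [->|rn] := eqVneq r 0; first by rewrite !mulr0 lee_fin.
  by rewrite invfM mulrA divff// mul1r mulVf.
have -> : ((powR a a)%:E * +oo = +oo)%E by rewrite gt0_muley// lte_fin powR_gt0.
by rewrite /= invr0 mulr0 mul0e.
Qed.

End Gamma.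


(** * The gamma mixing density and the comparison of the mixture with the gamma ratio *)

Section Mixture.
Context {R : realType}.
Notation mu := (@lebesgue_measure R).

(* Under [v = exp (B * lam)] the mixing density [exp (- theta * psiB lam)] of [lam]
   becomes this truncated gamma density. *)
Definition mixing_density (a v : R) : R :=
  gamma_const a * (powR v (a - 1) * expR (- (a * v))).

Definition gamma_term (B a0 s nu : R) : R :=
  let a := (B * s + nu) / B ^+ 2 + a0 in
  let x := nu / B ^+ 2 + a0 in
  gamma_const a0 * (GammaF a * gbar a x / powR x a) * expR (nu / B ^+ 2).

Lemma mixing_density_ge0 a v : 0 <= mixing_density a v.
Proof. by apply: mulr_ge0; [exact: gamma_const_ge0|rewrite mulr_ge0 ?powR_ge0 ?expR_ge0]. Qed.

Lemma measurable_mixing_density a : measurable_fun setT (mixing_density a).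
Proof.
apply: measurable_funM => //; apply: measurable_funM; first exact: measurable_powR.
by apply: measurable_expR_comp; apply: measurable_funN; exact: measurable_funM.
Qed.

Lemma integral_mixing_density a : 0 < a ->
  (\int[mu]_(v in `[1%R, +oo[) (mixing_density a v)%:E <= 1)%E.
Proof.
move=> a0; apply: le_trans (gamma_const_normalizes a a0).
rewrite -ge0_integralZl//; last 3 first.
- apply: measurable_funTS; apply/measurable_EFinP; apply: measurable_funM.
    exact: measurable_powR.
  by apply: measurable_expR_comp; apply: measurable_funN; exact: measurable_funM.
- by move=> v _; rewrite lee_fin mulr_ge0 ?powR_ge0 ?expR_ge0.
- by rewrite lee_fin gamma_const_ge0.
Qed.

(** Since [psiB B (ln v / B) = (v - 1 - ln v) / B^2], the left side equals
    [exp (lam s) exp (- psi nu)] times the mixing density, with [lam = ln v / B]. It remains to use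
    [exp x <= 2 cosh x], the source of the factor 2, and [sg <= nu] with [psi >= 0]. *)
Lemma gamma_integrand_le (B a0 s nu sg v : R) : 0 < B -> sg <= nu -> 1 <= v ->
  gamma_const a0 * expR (nu / B ^+ 2) *
    (powR v ((B * s + nu) / B ^+ 2 + a0 - 1) * expR (- ((nu / B ^+ 2 + a0) * v))) <=
  2 * (cosh (ln v / B * s) * expR (- (psiB B (ln v / B) * sg)) * mixing_density a0 v).
Proof.
move=> B0 sgnu v1; have v0 : 0 < v by apply: lt_le_trans v1.
have vn : (v == 0) = false by rewrite gt_eqF.
have vE : expR (ln v) = v by rewrite lnK// posrE.
have Bn : B != 0 by rewrite gt_eqF.
have psiE : psiB B (ln v / B) = (v - 1 - ln v) / B ^+ 2 by rewrite /psiB mulfVK// vE.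
have psi0 := psiB_ge0 B (ln v / B).
pose E1 := expR (ln v / B * s); pose E2 := expR (- (psiB B (ln v / B) * nu)).
have -> : gamma_const a0 * expR (nu / B ^+ 2) *
    (powR v ((B * s + nu) / B ^+ 2 + a0 - 1) * expR (- ((nu / B ^+ 2 + a0) * v)))
    = E1 * E2 * mixing_density a0 v.
  rewrite /mixing_density /powR vn /E1 /E2 psiE.
  rewrite -[LHS]mulrA [RHS]mulrCA; congr (_ * _).
  by rewrite -!expRD; congr expR; field.
rewrite mulrA ler_wpM2r ?mixing_density_ge0// mulrA.
apply: ler_pM; rewrite ?expR_ge0//; first exact: expR_le_cosh.
by rewrite ler_expR lerN2 ler_wpM2l.
Qed.

Lemma gamma_term_le (B a0 s nu sg : R) : 0 < B -> 0 < a0 -> 0 <= nu -> sg <= nu ->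
  ((gamma_term B a0 s nu)%:E <= 2%:E * \int[mu]_(v in `[1%R, +oo[)
     (cosh (ln v / B * s) * expR (- (psiB B (ln v / B) * sg)) * mixing_density a0 v)%:E)%E.
Proof.
move=> B0 a00 nu0 sgnu; rewrite /gamma_term.
set a := _ + a0; set x := nu / _ + a0.
have x0 : 0 < x by rewrite ltr_wpDl// divr_ge0// sqr_ge0.
have xa : 0 < powR x a by rewrite powR_gt0.
have mk : measurable_fun setT (fun v => powR v (a - 1) * expR (- (x * v)))%R.
  apply: measurable_funM; first exact: measurable_powR.
  by apply: measurable_expR_comp; apply: measurable_funN; exact: measurable_funM.
have k0 v : 0 <= powR v (a - 1) * expR (- (x * v)) by rewrite mulr_ge0 ?powR_ge0 ?expR_ge0.
have hK : ((GammaF a * gbar a x / powR x a)%:E <=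
    \int[mu]_(v in `[1%R, +oo[) (powR v (a - 1) * expR (- (x * v)))%R%:E)%E.
  rewrite mulrC -(@lee_pmul2l _ (powR x a)%:E)// ?lte_fin//.
  by rewrite -upper_gammaE// -EFinM mulVKf ?gt_eqF// GammaF_gbar_le.
rewrite mulrAC EFinM.
apply: (@le_trans _ _ ((gamma_const a0 * expR (nu / B ^+ 2))%:E *
    \int[mu]_(v in `[1%R, +oo[) (powR v (a - 1) * expR (- (x * v)))%R%:E)%E).
  by rewrite lee_wpmul2l// lee_fin mulr_ge0 ?gamma_const_ge0 ?expR_ge0.
have mm : measurable_fun setT (fun v => cosh (ln v / B * s) *
    expR (- (psiB B (ln v / B) * sg)) * mixing_density a0 v).
  have mlam : measurable_fun setT (fun v : R => ln v / B).
    by apply: measurable_funM => //; exact: measurable_ln.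
  apply: measurable_funM; last exact: measurable_mixing_density.
  apply: measurable_funM; first by apply: measurable_cosh; exact: measurable_funM.
  apply: measurable_expR_comp; apply: measurable_funN; apply: measurable_funM => //.
  apply: measurable_funM => //; apply: measurable_funB; last exact: measurable_funM.
  by apply: measurable_funB => //; apply: measurable_expR_comp; exact: measurable_funM.
have m0 v : 0 <= cosh (ln v / B * s) *
    expR (- (psiB B (ln v / B) * sg)) * mixing_density a0 v.
  apply: mulr_ge0; last exact: mixing_density_ge0.
  by rewrite mulr_ge0 ?expR_ge0// ltW// cosh_gt0.
rewrite -!ge0_integralZl//; last 5 first.
- exact/measurable_funTS/measurable_EFinP.
- by move=> v _; rewrite lee_fin.
- exact/measurable_funTS/measurable_EFinP.
- by move=> v _; rewrite lee_fin.
- by rewrite lee_fin mulr_ge0 ?gamma_const_ge0 ?expR_ge0.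
apply: ge0_le_integral => //.
- move=> v _; rewrite -EFinM lee_fin; apply: mulr_ge0; last exact: k0.
  by rewrite mulr_ge0 ?gamma_const_ge0 ?expR_ge0.
- by apply/measurable_funTS/measurable_EFinP; exact: measurable_funM.
- by apply/measurable_funTS/measurable_EFinP; exact: measurable_funM.
move=> v /=; rewrite in_itv/= andbT => v1; rewrite -!EFinM lee_fin.
exact: gamma_integrand_le.
Qed.

Lemma measurable_gamma_term d (T : measurableType d) (B a0 : R) (s nu : T -> R) :
  measurable_fun setT s -> measurable_fun setT nu ->
  measurable_fun setT (fun z => gamma_term B a0 (s z) (nu z)).
Proof.
move=> ms mnu.
have mx : measurable_fun setT (fun z => nu z / B ^+ 2 + a0).
  by apply: measurable_funD => //; exact: measurable_funM.
have ma : measurable_fun setT (fun z => (B * s z + nu z) / B ^+ 2 + a0).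
  apply: measurable_funD => //; apply: measurable_funM => //.
  by apply: measurable_funD => //; exact: measurable_funM.
apply: measurable_funM; last by apply: measurable_expR_comp; exact: measurable_funM.
apply: measurable_funM => //; apply: measurable_funM; last first.
  by apply: measurable_inv; exact: measurable_powR2.
apply: measurable_funM; first exact: measurable_GammaF.
apply: measurable_funM; first by apply: measurable_inv; exact: measurable_GammaF.
apply: (measurableT_comp (fine_measurable _)) => //.
exact: measurable_upper_gamma.
Qed.

End Mixture.

(** * The time-uniform bound, by combining the two failure events *)

Theorem theorem5 (R : realType) (H : lmodType R) (ip : H -> H -> R)
  (d : measure_display) (Omega : measurableType d) (P : probability Omega R)
  (F : nat -> set (set Omega)) (X : nat -> Omega -> H) (eps : nat -> Omega -> R)
  (B sigma2 rho delta1 delta2 : R) (shat : nat -> Omega -> R) (theta : R) :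
  real_separable_hilbert ip ->
  filtration F ->
  (forall t, (1 <= t)%N -> Gmeas_H ip (F t.-1) (X t)) ->
  (forall t, (1 <= t)%N -> Gmeas_R (F t) (eps t)) ->
  (forall t, (1 <= t)%N -> is_condexp P (F t.-1) (eps t) (fun _ => 0)) ->
  0 < B ->
  (forall t w, (1 <= t)%N -> `|eps t w| <= B) ->
  (forall t, (1 <= t)%N -> is_condvar P (F t.-1) (eps t) (fun _ => sigma2)) ->
  0 < rho ->
  0 < delta1 -> 0 < delta2 -> delta1 + delta2 < 1 ->
  (forall t, measurable_fun setT (shat t)) ->
  ((1 - delta1)%:E <= P [set w | forall t, (1 <= t)%N -> (sigma2 <= shat t w)%R])%E ->
  0 < theta ->
  let V t w : H -> H := fun x => \sum_(1 <= i < t.+1) rank_one ip (X i w) (X i w) x in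
  let M t w : H := \sum_(1 <= i < t.+1) eps i w *: X i w in
  let Tinv t w : H -> H := inv_sqrt_op ip (fun x => rho *: x + V t w x) in
  let G t w : H := Tinv t w (X t w) in
  let s t w : R := hnorm ip (Tinv t w (M t w)) in
  let nu t w : R := shat t w * \sum_(1 <= i < t.+1) hnorm ip (G i w) ^+ 2 in
  let a0 : R := theta / B ^+ 2 in
  let c0 : R := powR a0 a0 / (GammaF a0 * gbar a0 a0) in
  let term t w : R :=
    let a := (B * s t w + nu t w + theta) / B ^+ 2 in
    let x := (nu t w + theta) / B ^+ 2 in
    c0 * (GammaF a * gbar a x / powR x a) * expR (nu t w / B ^+ 2) in
  ((1 - delta1 - delta2)%:E <=
     P [set w | ereal_sup [set (term t w)%:E | t in [set t | (1 <= t)%N]]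
                < (2 / delta2)%:E]%E)%E.
Proof.
move=> ipH fF mX meps ceps B0 beps veps rho0 d10 d20 d12 mshat Pgood th0.
(* The [let]s of the statement sit under the coercion [is_true]. *)
pose V t w : H -> H := fun x => \sum_(1 <= i < t.+1) rank_one ip (X i w) (X i w) x.
pose M t w : H := \sum_(1 <= i < t.+1) eps i w *: X i w.
pose Tinv t w : H -> H := inv_sqrt_op ip (fun x => rho *: x + V t w x).
pose G t w : H := Tinv t w (X t w).
pose s t w : R := hnorm ip (Tinv t w (M t w)).
pose nu t w : R := shat t w * \sum_(1 <= i < t.+1) hnorm ip (G i w) ^+ 2.
pose a0 : R := theta / B ^+ 2.
pose c0 : R := powR a0 a0 / (GammaF a0 * gbar a0 a0).
pose term t w : R :=
  let a := (B * s t w + nu t w + theta) / B ^+ 2 in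
  let x := (nu t w + theta) / B ^+ 2 in
  c0 * (GammaF a * gbar a x / powR x a) * expR (nu t w / B ^+ 2).
pose sq := sqs ip X eps rho; pose gs := gains ip X rho.
have sF t : sub_sigma (F t) by case: fF.
have sE t w : s t w = Num.sqrt (sq t w).
  rewrite /sq /sqs /covform -(inv_sqrt_op_sqr ip ipH rho (X^~ w) rho0) sqrtr_sqr.
  by rewrite ger0_norm// hnorm_ge0.
have nuE t w : nu t w = shat t w * gs t w.
  congr (_ * _); apply: eq_bigr => i _.
  exact: (inv_sqrt_op_sqr ip ipH rho (X^~ w) rho0).
have termE t w : term t w = gamma_term B a0 (s t w) (nu t w).
  by rewrite /term /gamma_term /c0 /a0 !mulrDl.
have a00 : 0 < a0 by rewrite divr_gt0// exprn_gt0.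
have msq t : measurable_fun setT (sq t).
  apply: (adapted_measurable _ _ (F t)) => //.
  exact: (adapted_sqs ip F X eps rho).
have mgs t : measurable_fun setT (gs t).
  apply: (adapted_measurable _ _ (F t)) => //.
  exact: (adapted_gains ip F X rho).
have mterm t : measurable_fun setT (fun w => (term t w)%:E).
  apply/measurable_EFinP.
  have -> : term t = fun w => gamma_term B a0 (Num.sqrt (sq t w)) (shat t w * gs t w).
    by apply/funext => w; rewrite termE sE nuE.
  apply: measurable_gamma_term; first exact: measurable_sqrt.
  exact: measurable_funM.
pose L := mixture ip X eps B sigma2 rho (mixing_density a0).
(* Level [1 / delta2] for the mixture corresponds to [2 / delta2] for [term], because
   [term <= 2 * L]. *)
pose bad := [set w | (delta2^-1)%:E <= ereal_sup (range (L^~ w))]%E.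
pose good := [set w | forall t, (1 <= t)%N -> (sigma2 <= shat t w)%R].
pose goal := [set w | ereal_sup [set (term t w)%:E | t in [set t | (1 <= t)%N]]
                < (2 / delta2)%:E]%E.
suff : ((1 - delta1 - delta2)%:E <= P goal)%E by [].
have Pbad : (P bad <= delta2%:E)%E.
  exact: (mixture_ville ip P F X eps B sigma2 rho ipH fF mX meps ceps B0 beps veps rho0
    (mixing_density a0) (mixing_density_ge0 a0) (measurable_mixing_density a0)
    (integral_mixing_density a0 a00) delta2 d20).
have mL t : measurable_fun setT (L t).
  apply: (adapted_measurable _ _ (F t)) => //.
  exact: (adapted_mixture ip F X eps B sigma2 rho ipH fF mX meps (mixing_density a0)
    (mixing_density_ge0 a0) (measurable_mixing_density a0)).
have mbad : measurable bad.
  have msup : measurable_fun setT (fun w => ereal_sup (range (L^~ w))).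
    have := @measurable_fun_esups _ _ _ setT L mL 0%N.
    apply: eq_measurable_fun => w _; rewrite /esups; congr ereal_sup.
    by apply/seteqP; split => [_ [n _ <-]|_ [n _ <-]]; exists n.
  by have := emeasurable_fun_c_infty measurableT msup (delta2^-1)%:E; rewrite setTI.
have mgood : measurable good.
  have -> : good = \bigcap_(t in [set t | (1 <= t)%N]) [set w | sigma2 <= shat t w].
    by apply/seteqP; split => w h t /h.
  apply: bigcap_measurable => [|t _]; first by exists 1%N.
  have := mshat t measurableT `[sigma2, +oo[%classic (measurable_itv _).
  by rewrite setTI (_ : _ @^-1` _ = [set w | sigma2 <= shat t w])//; apply/seteqP; split => w;
    rewrite /= in_itv/= andbT.
have mgoal : measurable goal.
  have msup : measurable_fun setT (fun w => ereal_sup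
      [set (term t w)%:E | t in [set t | (1 <= t)%N]]).
    have := @measurable_fun_esups _ _ _ setT (fun t w => (term t w)%:E) mterm 1%N.
    exact: eq_measurable_fun.
  by have := emeasurable_fun_infty_o measurableT msup (2 / delta2)%:E; rewrite setTI.
have sub : good `\` bad `<=` goal.
  move=> w [gw /negP]; rewrite -ltNge => hw.
  have : (ereal_sup [set (term t w)%:E | t in [set t | (1 <= t)%N]] <=
      2%:E * ereal_sup (range (L^~ w)))%E.
    apply: ub_ereal_sup => _ [t t1 <-].
    apply: (@le_trans _ _ (2%:E * L t w)%E); last first.
      by rewrite lee_wpmul2l// ?lee_fin// ereal_sup_ubound//; exists t.
    have gs0 : 0 <= gs t w by exact: (gains_ge0 ip X rho ipH rho0).
    have sg0 : 0 <= sigma2 by exact: (sigma2_ge0 P F eps sigma2 fF ceps veps).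
    (* The only use of the variance bound: on [good] the computable [nu] dominates the true
       compensator, and since [sigma2 >= 0] it is also nonnegative. *)
    have sgnu : sigma2 * gs t w <= nu t w by rewrite nuE ler_wpM2r// gw.
    have nu0 : 0 <= nu t w by apply: le_trans sgnu; exact: mulr_ge0.
    rewrite termE; apply: le_trans (gamma_term_le B a0 (s t w) (nu t w) _ B0 a00 nu0 sgnu) _.
    rewrite lee_wpmul2l// ?lee_fin// /L /mixture le_eqVlt; apply/orP; left; apply/eqP.
    by apply: eq_integral => v _; rewrite /coshproc sE mulrA.
  move/le_lt_trans; apply.
  rewrite EFinM lte_pmul2l// ?lte_fin//.
(* A union bound: [good] is covered by [bad] and [good] minus [bad], the latter lying in [goal]. *)
have : (P good - P bad <= P goal)%E.
  apply: (@le_trans _ _ (P (good `\` bad))); last first.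
    by rewrite le_measure ?inE//; exact: measurableD.
  rewrite leeBlDr ?fin_num_measure//.
  apply: (@le_trans _ _ (P ((good `\` bad) `|` bad))).
    rewrite le_measure ?inE//; first by apply: measurableU => //; exact: measurableD.
    by move=> w gw; have [|] := pselect (bad w); [right|left].
  by apply: measureU2 => //; exact: measurableD.
apply: le_trans; rewrite EFinB; apply: leeB => //.
Qed.
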